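(* Let $1\le L\le N$ and consider the one-dimensional OFDM signal $\mathbf{x}=\mathbf{F}_N^H\mathbf{s}$ of length $N$ with $L$ deterministic unit-amplitude pilots and i.i.d. random data symbols on the remaining indices, with $g$, $h$, $\mathcal{D}_h$, $\mathcal{L}_{g,h}$, $\mathcal{U}_{g,h}$ as defined in the context. For the number of sidelobes that attain the lower bound, $$\mathrm{Card}(\mathcal{L}_{g,h})\leq\frac{N}{L}(L-1)\cdot\mathrm{Card}(\mathcal{D}_h)\leq\frac{N}{L}(L-1)^2,\qquad(\mathrm{A})$$ and for the number of sidelobes that attain the upper bound, $$\mathrm{Card}(\mathcal{U}_{g,h})\leq\frac{N}{L}\cdot\mathrm{Card}(\mathcal{D}_h)\leq\frac{N}{L}(L-1).\qquad(\mathrm{B})$$ The two inequalities in (A) are tight only when the pilot pattern is equally spaced with a period of $N/L\in\mathbb{Z}$ and the pilot symbols take the following form of chirp sequence: $$p_{l\frac{N}{L}}=\begin{cases}A\, e^{-j\frac{\pi u}{L}l(l+1)}\, e^{j\frac{2\pi\nu}{L}l}, & \text{if } L \text{ is odd},\\ A\, e^{-j\frac{\pi u}{L}l^2}\, e^{j\frac{2\pi\nu}{L}l}, & \text{if } L\text{ is even},\end{cases}\qquad(\mathrm{C})$$ where $l=0,\dots,L-1$, $A\in\mathbb{C}$, $|A|=1$, and $u,\nu\in\mathbb{Z}$. Similarly, the two inequalities in (B) are tight only under the same conditions. The corresponding expected squared DP-AF (i.e. for the equally spaced pattern with pilot symbols (C)) is, for $(k,q)\in\mathbb{Z}_N^2$,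 $$\mathbb{E}\left(|\mathcal{X}^{\mathrm{DP}}(k,q)|^2\right)=\begin{cases}N^2\delta_{k,0}+(\kappa-1)(N-L), & \text{if } q=0,\\ N+L^2-L, & \text{if } q=m\frac{N}{L},\ L\mid(k-um),\\ N-L, & \text{if } q=m\frac{N}{L},\ L\nmid(k-um),\\ N, & \text{otherwise},\end{cases}$$ where $m=1,2,\dots,L-1$. This expression is independent of $A$ and $\nu$. When $A=1$ and $\nu=0$, the chirp sequence (C) reduces to the Zadoff-Chu sequence.
   Context: Let $j$ be the imaginary unit, $\mathbb{Z}_N=\{0,1,\dots,N-1\}$, $\langle\cdot\rangle_N$ reduction modulo $N$, $\mathrm{Card}$ the number of elements, $\delta_{a,b}$ the Kronecker delta; $a\mid b$ means $b$ is a multiple of $a$, and $a\nmid b$ its negation. Indices start from $0$. $\mathbf{F}_N$ is the normalized DFT matrix with entries $(\mathbf{F}_N)_{m,n}=\frac{1}{\sqrt N}e^{-j2\pi mn/N}$. Signal model. $I\subseteq\mathbb{Z}_N$ is a set with $L$ elements (the pilot pattern); it is equally spaced with period $N/L$ if cyclically consecutive elements of $I$ differ by $N/L$. The symbol vector $\mathbf{s}\in\mathbb{C}^N$ has deterministic pilot entries $s_i$ with $|s_i|=1$ for $i\in I$ (unit-amplitude pilots), while the entries $s_i$, $i\notin I$, are i.i.d. random data symbols, each distributed as a complex random variable $d$ with finite fourth moment and $$\mathbb{E}(d)=0,\quad \mathbb{E}(|d|^2)=1,\quad \mathbb{E}(d^2)=0,\quad \mathbb{E}(d|d|^2)=\mathbb{E}(d^*|d|^2)=0.$$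 The kurtosis is $\kappa=\mathbb{E}(|d|^4)$. The pilot vector $\mathbf{p}$ has $p_i=s_i$ for $i\in I$ and $p_i=0$ otherwise; the mask $\mathbf{w}$ has $w_i=1$ for $i\in I$ and $w_i=0$ otherwise. Ambiguity function. $\mathbf{R}_{N,k}$ is the cyclic shift, $(\mathbf{R}_{N,k}\mathbf{x})_n=x_{\langle n-k\rangle_N}$, and $\mathbf{\Phi}_{N,q}=\mathrm{Diag}(1,e^{j2\pi q/N},\dots,e^{j2\pi q(N-1)/N})$. The discrete periodic ambiguity function (DP-AF) is $\mathcal{X}^{\mathrm{DP}}(k,q)=\mathbf{x}^H\mathbf{R}_{N,k}^T\mathbf{\Phi}_{N,q}^*\mathbf{x}$ with $\mathbf{x}=\mathbf{F}_N^H\mathbf{s}$, for delay index $k$ and Doppler index $q$, $(k,q)\in\mathbb{Z}_N^2$. Auxiliary quantities: $$g(k,q)=\left|\sum_{n=0}^{N-1}p_np_{\langle n-q\rangle_N}^*e^{j2\pi nk/N}\right|^2,\qquad h(q)=\sum_{n=0}^{N-1}w_nw_{\langle n-q\rangle_N},$$ $$\mathcal{D}_h=\{q\in\mathbb{Z}_N:\ q\neq0,\ h(q)=L\},$$ $$\mathcal{L}_{g,h}=\{(k,q)\in\mathbb{Z}_N^2:\ q\neq 0,\ q\in\mathcal{D}_h,\ g(k,q)=0\},$$ $$\mathcal{U}_{g,h}=\{(k,q)\in\mathbb{Z}_N^2:\ q\neq 0,\ q\in\mathcal{D}_h,\ g(k,q)=L^2\}.$$ For $q\neq0$ the expected squared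 DP-AF equals $g(k,q)+N-h(q)$ and lies between the lower bound $N-L$ and the upper bound $N+L^2-L$; $\mathcal{L}_{g,h}$ and $\mathcal{U}_{g,h}$ are the sets of nonzero-Doppler index pairs at which the lower and upper bound, respectively, is attained.
   Formalization: In (C) the pilots are listed from any base index i0 in I, as p_{i0+lN/L} modulo N, instead of p_{lN/L}, since the literal claim fails for equally spaced patterns not containing 0; with 0 in I, i0=0 gives (C) as written. *)

(* Defs.v *)
From mathcomp Require Import all_boot all_order all_algebra.
From mathcomp Require Import all_classical all_reals all_analysis.
From mathcomp Require Import complex.

Set Implicit Arguments.
Unset Strict Implicit.
Unset Printing Implicit Defensive.

Import Order.TTheory GRing.Theory Num.Theory.
Import numFieldNormedType.Exports.
Import ComplexField.Normc.

Local Open Scope ring_scope.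
Local Open Scope complex_scope.

(* [addmod n t] is <n + t>_N.  Working with an element [n : 'I_N] and a
   natural-number offset avoids assuming that N is a successor. *)
Definition addmod (N : nat) (n : 'I_N) (t : nat) : 'I_N :=
  Ordinal (ltn_pmod (n + t) (leq_ltn_trans (leq0n n) (ltn_ord n))).

(* <n - k>_N; the truncated subtraction is harmless because k < N. *)
Definition submod (N : nat) (n k : 'I_N) : 'I_N := addmod n (N - k).

(* e^{j t} *)
Definition cis (R : realType) (t : R) : R[i] := cos t +i* sin t.

Section LinearAlgebra.
Variables (R : realType) (N : nat).

Definition hermitian m n (A : 'M[R[i]]_(m, n)) : 'M[R[i]]_(n, m) :=
  map_mx (@conjc R) A^T.

Definition dft : 'M[R[i]]_N :=
  \matrix_(m, n) ((Num.sqrt N%:R)^-1%:C *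
                  cis (- (2 * pi * (m * n)%:R / N%:R))).

(* (cyclic_shift k *m x) n = x <n - k>_N *)
Definition cyclic_shift (k : 'I_N) : 'M[R[i]]_N :=
  \matrix_(n, m) (m == submod n k)%:R.

Definition doppler (q : 'I_N) : 'M[R[i]]_N :=
  diag_mx (\row_n cis (2 * pi * (q * n)%:R / N%:R)).

Definition dpaf (x : 'cV[R[i]]_N) (k q : 'I_N) : R[i] :=
  (hermitian x *m (cyclic_shift k)^T *m map_mx (@conjc R) (doppler q) *m x)
    0 0.

Definition ofdm (s : 'cV[R[i]]_N) : 'cV[R[i]]_N := hermitian dft *m s.

End LinearAlgebra.

Section Pilots.
Variables (R : realType) (N : nat) (I : {set 'I_N}).

(* Cyclically consecutive elements of I differ by T: the first element of I
   met after i, going around Z_N, is <i + T>_N (i itself when #|I| = 1). *)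
Definition equally_spaced (T : nat) : Prop :=
  (0 < T)%N /\
  forall i : 'I_N, i \in I ->
    addmod i T \in I /\
    forall t : nat, (0 < t < T)%N -> addmod i t \notin I.

(* Pilot values are read off from c on I only. *)
Definition pilot (c : 'I_N -> R[i]) (i : 'I_N) : R[i] :=
  if i \in I then c i else 0.

Definition pilot_mask (i : 'I_N) : nat := i \in I.

Definition g (c : 'I_N -> R[i]) (k q : 'I_N) : R :=
  normc (\sum_(n < N) pilot c n * conjc (pilot c (submod n q)) *
                      cis (2 * pi * (n * k)%:R / N%:R)) ^+ 2.

Definition h (q : 'I_N) : nat :=
  (\sum_(n < N) pilot_mask n * pilot_mask (submod n q))%N.

Definition Dset : {set 'I_N} :=
  [set q : 'I_N | ((q : nat) != 0) && (h q == #|I|)]%N.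

Definition Lset (c : 'I_N -> R[i]) : {set 'I_N * 'I_N} :=
  [set kq : 'I_N * 'I_N |
    [&& (kq.2 : nat) != 0%N, kq.2 \in Dset & g c kq.1 kq.2 == 0]].

Definition Uset (c : 'I_N -> R[i]) : {set 'I_N * 'I_N} :=
  [set kq : 'I_N * 'I_N |
    [&& (kq.2 : nat) != 0%N, kq.2 \in Dset
      & g c kq.1 kq.2 == #|I|%:R ^+ 2]].

End Pilots.

Section Chirp.
Variable R : realType.

Definition chirp (L : nat) (A : R[i]) (u nu : int) (l : nat) : R[i] :=
  A * cis (- (pi * u%:~R / L%:R *
              (if odd L then l * (l + 1) else l ^ 2)%N%:R))
    * cis (2 * pi * nu%:~R / L%:R * l%:R).

(* Root-u Zadoff-Chu sequence exp (- j pi u l (l + c_L) / L), with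
   c_L = L mod 2.  The usual requirement that u be coprime to L is not
   imposed. *)
Definition zadoff_chu (L : nat) (u : int) (l : nat) : R[i] :=
  cis (- (pi * u%:~R * l%:R * (l + L %% 2)%N%:R / L%:R)).

(* The pilots form a chirp when listed with step N / L from index i0.  For
   i0 = 0 this reads p_(l N / L) = chirp L A u nu l; a general base index is
   needed because an equally spaced pattern need not contain 0. *)
Definition chirp_pilots (N L : nat) (I : {set 'I_N}) (c : 'I_N -> R[i])
    (i0 : 'I_N) (A : R[i]) (u nu : int) : Prop :=
  forall l : nat, (l < L)%N ->
    pilot I c (addmod i0 (l * (N %/ L))) = chirp L A u nu l.

(* At most one m satisfies the conditions when 1 <= L, L %| N and q < N. *)
Definition chirp_sqr_dpaf (N L : nat) (kappa : R) (u : int) (k q : 'I_N) : R :=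
  if (q : nat) == 0%N then
    N%:R ^+ 2 * ((k : nat) == 0%N)%:R + (kappa - 1) * (N%:R - L%:R)
  else if [exists m : 'I_L, [&& (0 < m)%N, q == (m * (N %/ L))%N :> nat
                              & (L%:Z %| k%:Z - u * m%:Z)%Z]] then
    N%:R + L%:R ^+ 2 - L%:R
  else if [exists m : 'I_L, [&& (0 < m)%N, q == (m * (N %/ L))%N :> nat
                              & ~~ (L%:Z %| k%:Z - u * m%:Z)%Z]] then
    N%:R - L%:R
  else N%:R.

End Chirp.

Section Probability.
Variables (R : realType).

Definition pair_of_complex (z : R[i]) : R * R := (complex.Re z, complex.Im z).

(* C carries the sigma-algebra transported from R * R. *)
Definition complex_rv d (T : measurableType d) (X : T -> R[i]) : Prop :=
  measurable_fun setT (pair_of_complex \o X).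

Definition complex_expectation d (T : measurableType d) (P : probability T R)
    (X : T -> R[i]) : R[i] :=
  fine ('E_P[fun t => complex.Re (X t)])%E +i*
  fine ('E_P[fun t => complex.Im (X t)])%E.

Record data_symbol d (T : measurableType d) (P : probability T R)
    (X : T -> R[i]) : Prop := DataSymbol {
  data_symbol_rv : complex_rv X;
  data_symbol_moment4 : ('E_P[fun t => (normc (X t) ^+ 4)%R] < +oo)%E;
  data_symbol_mean : complex_expectation P X = 0;
  data_symbol_power : ('E_P[fun t => (normc (X t) ^+ 2)%R] = 1%:E)%E;
  data_symbol_pseudo : complex_expectation P (fun t => X t ^+ 2) = 0;
  data_symbol_third :
    complex_expectation P (fun t => X t * (normc (X t) ^+ 2)%:C) = 0;
  data_symbol_third_conj :
    complex_expectation P (fun t => conjc (X t) * (normc (X t) ^+ 2)%:C) = 0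
}.

Definition kurtosis d (T : measurableType d) (P : probability T R)
    (X : T -> R[i]) : R :=
  fine ('E_P[fun t => (normc (X t) ^+ 4)%R])%E.

Definition same_law d (T : measurableType d) (P : probability T R)
    d' (T' : measurableType d') (P' : probability T' R)
    (X : T -> R[i]) (Y : T' -> R[i]) : Prop :=
  forall B : set (R * R), measurable B ->
    P ((pair_of_complex \o X) @^-1` B)%classic =
    P' ((pair_of_complex \o Y) @^-1` B)%classic.

Definition mutually_independent d (T : measurableType d) (P : probability T R)
    (J : finType) (S : {set J}) (X : J -> T -> R[i]) : Prop :=
  forall (K : {set J}) (B : J -> set (R * R)), K \subset S ->
    (forall i, measurable (B i)) ->
    P (\bigcap_(i in [set i | i \in K])
         ((pair_of_complex \o X i) @^-1` B i))%classic =
    (\prod_(i in K) P ((pair_of_complex \o X i) @^-1` B i)%classic)%E.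

Record iid_copies d (T : measurableType d) (P : probability T R)
    (J : finType) (S : {set J}) (X : J -> T -> R[i])
    d' (T' : measurableType d') (P' : probability T' R) (Y : T' -> R[i]) :
    Prop := IidCopies {
  iid_copies_rv : forall i, i \in S -> complex_rv (X i);
  iid_copies_law : forall i, i \in S -> same_law P P' (X i) Y;
  iid_copies_indep : mutually_independent P S X
}.

Definition symbols (N : nat) (I : {set 'I_N}) (c : 'I_N -> R[i])
    T (data : 'I_N -> T -> R[i]) (t : T) : 'cV[R[i]]_N :=
  \col_i (if i \in I then c i else data i t).

(* Extended-real valued, so that an equation with a real number includes
   integrability. *)
Definition expected_sqr_dpaf d (T : measurableType d) (P : probability T R)
    (N : nat) (I : {set 'I_N}) (c : 'I_N -> R[i]) (data : 'I_N -> T -> R[i])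
    (k q : 'I_N) : \bar R :=
  ('E_P[fun t => (normc (dpaf (ofdm (symbols I c data t)) k q) ^+ 2)%R])%E.

End Probability.

(* Main.v *)
From Pilot Require Import Defs.
From mathcomp Require Import all_boot all_order all_algebra.
From mathcomp Require Import all_classical all_reals all_analysis.
From mathcomp Require Import complex measurable_realfun.
From mathcomp Require Import ring lra zify.
Set Implicit Arguments.
Unset Strict Implicit.
Unset Printing Implicit Defensive.
Import numFieldNormedType.Exports.
Import Order.TTheory GRing.Theory Num.Theory.
Import ComplexField.Normc.
Local Open Scope ring_scope.
Local Open Scope complex_scope.

(* For a nonzero Doppler shift q in D_h, the pattern I is invariant under
   translation by q, and g(., q) is the squared modulus of the Fourier transform
   of L unimodular numbers.  Hence 0 <= g <= L^2 while Parseval gives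
   sum_k g(k, q) = N L, so that at most N / L of the N values of g equal L^2 and
   at least N / L of them are nonzero.  The translations preserving I form a
   subgroup of Z_N acting freely on I, so Card D_h <= L - 1, with equality only
   when I is a coset of the subgroup generated by N / L.  If all the bounds are
   attained, then g(k, N / L) = L^2 for some k; equality in the triangle
   inequality makes p_n p_(n - N / L)^* e^(2 pi j n k / N) constant on I, which
   is a first-order recurrence solved by chirps with u = k.
   For the expectation, the squared DP-AF is a double sum of quadruple products
   of symbols; independence, extended one coordinate at a time from indicators to
   nonnegative and then to complex functions, turns the mean of each into a
   product of moments, which vanishes unless all four indices are pilots or the two factors
   coincide, so that the mean is g + N - h for q <> 0. *)

(** * Expectations of products of independent random variables *)

Section ProductFormula.
Local Open Scope classical_set_scope.
Context d (T : measurableType d) (R : realType) (P : probability T R).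

Import HBNNSimple.

(** A simple function is the finite sum of its values times the indicators of its fibres; the weight
    [U] stays inside the integral. *)
Lemma integral_nnsfun_mul d' (T' : measurableType d') (X : T -> T') (U : T -> R)
    (h : {nnsfun T' >-> R}) :
  measurable_fun setT X -> measurable_fun setT U -> (forall t, 0 <= U t) ->
  (\int[P]_t (h (X t) * U t)%:E =
   \sum_(y \in range h) y%:E * \int[P]_t (\1_(h @^-1` [set y]) (X t) * U t)%:E)%E.
Proof.
move=> mX mU U0.
have m1 y : measurable_fun setT (fun t => \1_(h @^-1` [set y]) (X t) * U t).
  by apply: measurable_funM => //; apply: measurableT_comp mX.
transitivity (\int[P]_t (\sum_(y \in range h)
    (y * (\1_(h @^-1` [set y]) (X t) * U t))%:E))%E.
  apply: eq_integral => t _; rewrite fsumEFin //; congr EFin.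
  rewrite {1}(fimfunE h) !(@fsbig_finite _ _ _ _ (range h)) //= mulr_suml.
  by apply: eq_bigr => y _; rewrite mulrA.
rewrite ge0_integral_fsum //; first last.
- move=> y t _; rewrite lee_fin.
  (* A value outside the range could be negative, but its fibre is empty and the term is 0. *)
  have [[s _ <-]|ny] := pselect (range h y).
    by rewrite !mulr_ge0.
  rewrite indicE memNset ?mul0r ?mulr0 //= => hy.
  by apply: ny; exists (X t).
- by move=> y; apply/measurable_EFinP; apply: measurable_funM.
apply: eq_fsbigr => y /set_mem [s _ <-].
under eq_integral do rewrite EFinM.
rewrite ge0_integralZl_EFin //.
- by move=> t _; rewrite lee_fin mulr_ge0.
- exact/measurable_EFinP.
Qed.

(** The factorisation assumed for indicators passes to simple functions by linearity and to
    nonnegative [f] by monotone convergence. Finiteness of [a], which is the mean of [U], keeps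
    multiplication by [a] continuous in the limit. *)
Lemma ge0_integral_mul_indep d' (T' : measurableType d') (X : T -> T')
    (U : T -> R) (a : \bar R) :
  measurable_fun setT X -> measurable_fun setT U -> (forall t, 0 <= U t) ->
  a \is a fin_num ->
  (forall B, measurable B ->
    \int[P]_t (\1_B (X t) * U t)%:E = P (X @^-1` B) * a)%E ->
  forall f : T' -> R, measurable_fun setT f -> (forall x, 0 <= f x) ->
  (\int[P]_t (f (X t) * U t)%:E = \int[P]_t (f (X t))%:E * a)%E.
Proof.
move=> mX mU U0 afin XU f mf f0.
have mEf : measurable_fun setT (EFin \o f) by exact/measurable_EFinP.
pose g := nnsfun_approx measurableT mEf.
(* The weight is general because the limit is taken twice, with weight [U] and with weight 1. *)
have lim_int (V : T -> R) : measurable_fun setT V -> (forall t, 0 <= V t) ->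
    (\int[P]_t (g n (X t) * V t)%:E @[n --> \oo] -->
     \int[P]_t (f (X t) * V t)%:E)%E.
  move=> mV V0.
  rewrite (_ : \int[P]_t (f (X t) * V t)%:E =
      \int[P]_t limn (fun n => (g n (X t) * V t)%:E))%E; last first.
    apply: eq_integral => t _; apply/esym/cvg_lim => //.
    under eq_fun do rewrite EFinM.
    rewrite EFinM; apply: cvgeZr => //.
    have f0' x : setT x -> (0 <= (EFin \o f) x)%E by rewrite lee_fin.
    exact: (cvg_nnsfun_approx measurableT mEf f0' I).
  apply: (@cvg_monotone_convergence _ _ _ P setT measurableT
    (fun n t => (g n (X t) * V t)%:E)).
  - move=> n; apply/measurable_EFinP/measurable_funM => //.
    exact: measurableT_comp.
  - by move=> n t _; rewrite lee_fin mulr_ge0.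
  - move=> t _ m n mn; rewrite lee_fin ler_wpM2r //.
    by have /lefP := nd_nnsfun_approx measurableT mEf mn; exact.
have m1 : measurable_fun [set: T] (fun=> 1 : R) by [].
have lim1 := lim_int (fun=> 1) m1 (fun=> ler01).
have limU := lim_int U mU U0.
have gE n : (\int[P]_t (g n (X t) * U t)%:E =
    \int[P]_t (g n (X t) * 1)%:E * a)%E.
  rewrite !integral_nnsfun_mul //.
  rewrite ge0_mule_fsuml.
    apply: eq_fsbigr => y _; rewrite XU // -muleA; congr (_ * (_ * _))%E.
    under eq_integral do rewrite mulr1.
    have -> : (fun t => (\1_(g n @^-1` [set y]) (X t))%:E : \bar R) =
       (fun t => (\1_(X @^-1` (g n @^-1` [set y])) t)%:E).
      by apply/funext => t; rewrite !indicE.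
    by rewrite integral_indic ?setIT // -[X @^-1` _]setTI; exact: mX.
  move=> y; have [[s _ <-]|ny] := pselect (range (g n) y).
    by rewrite mule_ge0 ?lee_fin //; apply: integral_ge0 => t _; rewrite lee_fin mulr_ge0.
  rewrite integral0_eq ?mule0 // => t _; rewrite indicE memNset ?mul0r // => hy.
  by apply: ny; exists (X t).
rewrite (_ : \int[P]_t (f (X t))%:E = \int[P]_t (f (X t) * 1)%:E)%E; last first.
  by apply: eq_integral => t _; rewrite mulr1.
apply: (cvg_unique _ limU); first exact: ereal_hausdorff.
have /funext -> := gE.
exact: cvgeZr.
Qed.

End ProductFormula.

(** Scheme for passing from families with entries in a simple class [C0] to entries in a larger
    class [C1], one coordinate at a time: in the step, the claim is available for every replacement
    of the entry at [i] by a simple one. *)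
Lemma coordinatewise_ind (J : finType) (A : Type) (S : {set J})
    (C0 C1 : J -> A -> Prop) (Q : (J -> A) -> Prop) :
  (forall i a, i \in S -> C0 i a -> C1 i a) ->
  (forall F, (forall i, i \in S -> C0 i (F i)) -> Q F) ->
  (forall F i, i \in S -> (forall j, j \in S -> C1 j (F j)) ->
     (forall a, C0 i a -> Q [eta F with i |-> a]) -> Q F) ->
  forall F, (forall i, i \in S -> C1 i (F i)) -> Q F.
Proof.
move=> C01 Q0 step F F1.
(* [B] contains the coordinates not yet known to be simple; the induction is on its size. *)
suff: forall n (B : {set J}) G, (#|B| <= n)%N ->
    (forall i, i \in S -> C1 i (G i)) ->
    (forall i, i \in S -> i \notin B -> C0 i (G i)) -> Q G.
  by move=> /(_ _ S F (leqnn _) F1); apply => i ->.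
elim=> [|n IH] B G.
  by rewrite leqn0 cards_eq0 => /eqP -> _ G0; apply: Q0 => i iS; apply: G0; rewrite ?inE.
move=> cB G1 G0.
have [SB|/fintype.subsetPn [i iS iB]] := boolP (S \subset ~: B).
  by apply: Q0 => i iS; apply: G0 => //; have := fintype.subsetP SB i iS; rewrite inE.
rewrite inE negbK in iB.
apply: (step _ i) => // a C0a; apply: (IH (B :\ i)).
- by move: cB; rewrite (cardsD1 i) iB.
- by move=> j jS /=; case: eqP => [->|_]; [exact: C01|exact: G1].
- move=> j jS; rewrite !inE negb_and negbK /=.
  by case: eqP => [-> _|_ /= jB]; [|exact: G0].
Qed.

Section IndependentProducts.
Local Open Scope classical_set_scope.
Context d (T : measurableType d) (R : realType) (P : probability T R).
Variables (J : finType) (S : {set J}) (X : J -> T -> R[i]).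
Hypothesis mX : forall i, i \in S -> complex_rv (X i).
Hypothesis indep : mutually_independent P S X.

Local Notation Y i := (@pair_of_complex R \o X i).

Lemma measurable_prod_comp (F : J -> R * R -> R) (Q : pred J) :
  (forall i, i \in S -> measurable_fun setT (F i)) ->
  measurable_fun setT (fun t => \prod_(i in S | Q i) F i (Y i t)).
Proof.
move=> mF; under eq_fun do rewrite -big_filter.
apply: measurable_prod => i; rewrite mem_filter => /andP[/andP[iS _] _].
by apply: measurableT_comp; [exact: mF|exact: mX].
Qed.

Lemma measurable_preim i B : i \in S -> measurable B -> measurable (Y i @^-1` B).
Proof. by move=> iS mB; rewrite -[_ @^-1` _]setTI; exact: mX. Qed.

Lemma integral_indic_comp i B : i \in S -> measurable B ->
  (\int[P]_t (\1_B (Y i t) : R)%:E = P (Y i @^-1` B))%E.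
Proof.
move=> iS mB.
have mYB : measurable (Y i @^-1` B).
  exact: measurable_preim.
transitivity (\int[P]_t (\1_(Y i @^-1` B) t : R)%:E)%E; first by [].
by rewrite integral_indic // setIT.
Qed.

(** For indicators this is the definition of independence. One factor is then freed at a time, with
    the product of the others as the weight in [ge0_integral_mul_indep]. Finite integrals ensure
    that [fine] loses nothing. *)
Lemma ge0_integral_prod_indep (F : J -> R * R -> R) :
  (forall i, i \in S -> [/\ measurable_fun setT (F i), forall x, (0 <= F i x)%R
     & \int[P]_t (F i (Y i t))%:E < +oo]%E) ->
  (\int[P]_t (\prod_(i in S) F i (Y i t))%:E =
   (\prod_(i in S) fine (\int[P]_t (F i (Y i t))%:E))%:E)%E.
Proof.
pose C0 (i : J) (f : R * R -> R) := exists2 B, measurable B & f = \1_B.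
pose C1 (i : J) (f : R * R -> R) := [/\ measurable_fun setT f,
  forall x, (0 <= f x)%R & \int[P]_t (f (Y i t))%:E < +oo]%E.
move: F; apply: (coordinatewise_ind (C0 := C0) (C1 := C1)).
- move=> i _ iS [B mB ->]; split => //.
  rewrite (_ : (fun t => _) = (fun t => (\1_(Y i @^-1` B) t)%:E)) //.
  by rewrite integral_indic_comp // ltey_eq fin_num_measure //; exact: measurable_preim.
- move=> F FB.
  (* Off [S] an arbitrary measurable set is taken, so that choice yields a family indexed by all of
     [J]. *)
  have {}FB i : exists B, measurable B /\ (i \in S -> F i = \1_B).
    have [/FB [B mB FE]|_] := boolP (i \in S); first by exists B.
    by exists setT.
  have /choice [B BP] := FB.
  have mB i : measurable (B i) by case: (BP i).
  have FE i : i \in S -> F i = \1_(B i) by case: (BP i).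
  have PE : (P (\bigcap_(i in [set i | i \in S]) Y i @^-1` B i) =
      \prod_(i in S) P (Y i @^-1` B i))%E by exact: (indep (subxx S) mB).
  transitivity
    (\int[P]_t (\1_(\bigcap_(i in [set i | i \in S]) Y i @^-1` B i) t : R)%:E)%E.
    apply: eq_integral => t _; congr EFin.
    rewrite indicE; have [/set_mem tB|/negP tB] := boolP (t \in _).
      rewrite big1 // => i iS; rewrite FE // indicE mem_set //.
      exact: (tB i iS).
    suff [i iS tBi] : exists2 i, i \in S & ~ B i (Y i t).
      by rewrite (bigD1 i) //= FE // indicE memNset // mul0r.
    apply: contrapT => no; apply: tB; apply/mem_set => i /= iS.
    by apply: contrapT => tBi; apply: no; exists i.
  rewrite integral_indic // ?setIT; last first.
    apply: fin_bigcap_measurable; first exact: finite_finset.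
    by move=> i iS; exact: measurable_preim.
  apply: (eq_trans PE).
  have E i : i \in S -> (P (Y i @^-1` B i) = (fine (\int[P]_t (F i (Y i t))%:E))%:E)%E.
    move=> iS; rewrite FE // integral_indic_comp // fineK // fin_num_measure //.
    exact: measurable_preim.
  by rewrite (eq_bigr _ E) prodEFin.
- move=> F i iS F1 step.
  have [mFi Fi0 Fioo] := F1 i iS.
  pose a := \prod_(j in S | j != i) fine (\int[P]_t (F j (Y j t))%:E)%E.
  pose U t := \prod_(j in S | j != i) F j (Y j t).
  have UE f t : \prod_(j in S) [eta F with i |-> f] j (Y j t) = f (Y i t) * U t.
    rewrite (bigD1 i) //= eqxx; congr (_ * _); apply: eq_bigr => j /andP[_ ji].
    by rewrite (negbTE ji).
  have aE f : \prod_(j in S) fine (\int[P]_t ([eta F with i |-> f] j (Y j t))%:E)%E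
      = fine (\int[P]_t (f (Y i t))%:E)%E * a.
    rewrite (bigD1 i) //= eqxx; congr (_ * _); apply: eq_bigr => j /andP[_ ji].
    by rewrite (negbTE ji).
  (* Seen as its own update at [i], [F] fits the two splitting formulas [UE] and [aE]. *)
  have FE : F = [eta F with i |-> F i].
    by apply/funext => j /=; case: eqP => [->|].
  rewrite FE aE EFinM fineK.
    under eq_integral do rewrite UE.
    apply: (ge0_integral_mul_indep (a := a%:E)) => //.
    + exact: mX.
    + by apply: measurable_prod_comp => j jS; case: (F1 j jS).
    + by move=> t; apply: prodr_ge0 => j /andP[jS _]; case: (F1 j jS).
    + move=> B mB; have := step \1_B (ex_intro2 _ _ B mB erefl).
      rewrite aE EFinM integral_indic_comp // fineK; last first.
        by rewrite fin_num_measure //; exact: measurable_preim.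
      by under eq_integral do rewrite UE.
  by rewrite ge0_fin_numE //; apply: integral_ge0 => t _; rewrite lee_fin.
Qed.
End IndependentProducts.

(** * Linearity of the expectation of complex random variables *)

Section ComplexExpectation.
Local Open Scope classical_set_scope.
Context d (T : measurableType d) (R : realType) (P : probability T R).
Implicit Types f g : T -> R[i].

Definition complex_integrable f : Prop :=
  P.-integrable setT (fun t => (complex.Re (f t))%:E) /\
  P.-integrable setT (fun t => (complex.Im (f t))%:E).

Lemma complex_expectationE f :
  complex_expectation P f =
  Rintegral P setT (fun t => complex.Re (f t)) +i*
  Rintegral P setT (fun t => complex.Im (f t)).
Proof. by rewrite /complex_expectation !unlock. Qed.

Lemma eq_complex_expectation f g : f =1 g ->
  complex_expectation P f = complex_expectation P g.
Proof. by move=> /funext ->. Qed.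

Lemma eq_complex_integrable f g : f =1 g ->
  complex_integrable f -> complex_integrable g.
Proof. by move=> /funext ->. Qed.

Lemma complex_integrableD f g : complex_integrable f -> complex_integrable g ->
  complex_integrable (fun t => f t + g t).
Proof.
move=> [fr fi] [gr gi]; split.
  apply: eq_integrable (integrableD _ fr gr) => // t _.
  by rewrite raddfD.
apply: eq_integrable (integrableD _ fi gi) => // t _.
by rewrite raddfD.
Qed.

Lemma complex_expectationD f g : complex_integrable f -> complex_integrable g ->
  complex_expectation P (fun t => f t + g t) =
  complex_expectation P f + complex_expectation P g.
Proof.
move=> [fr fi] [gr gi]; rewrite !complex_expectationE.
apply/eqP; rewrite eq_complex /=; apply/andP; split; apply/eqP.
  rewrite -RintegralD //; apply: eq_Rintegral => t _; exact: raddfD.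
rewrite -RintegralD //; apply: eq_Rintegral => t _; exact: raddfD.
Qed.

Lemma complex_integrableZ (a : R[i]) f : complex_integrable f ->
  complex_integrable (fun t => a * f t).
Proof.
case: a => ar ai [fr fi]; split.
  apply: eq_integrable
    (integrableB _ (integrableZl _ ar fr) (integrableZl _ ai fi)) => // t _.
  by case: (f t).
apply: eq_integrable
  (integrableD _ (integrableZl _ ar fi) (integrableZl _ ai fr)) => // t _.
by case: (f t).
Qed.

Lemma complex_expectationZ (a : R[i]) f : complex_integrable f ->
  complex_expectation P (fun t => a * f t) = a * complex_expectation P f.
Proof.
case: a => ar ai [fr fi]; rewrite !complex_expectationE.
apply/eqP; rewrite eq_complex /=; apply/andP; split; apply/eqP.
  rewrite -!RintegralZl // -RintegralB //; last 2 first.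
  - exact: (integrableZl measurableT ar fr).
  - exact: (integrableZl measurableT ai fi).
  by apply: eq_Rintegral => t _; case: (f t).
rewrite -!RintegralZl // -RintegralD //; last 2 first.
- exact: (integrableZl measurableT ar fi).
- exact: (integrableZl measurableT ai fr).
by apply: eq_Rintegral => t _; case: (f t).
Qed.

Lemma complex_integrable_cst (a : R[i]) : complex_integrable (fun=> a).
Proof. by split; apply: finite_measure_integrable_cst. Qed.

Lemma complex_expectation_cst (a : R[i]) : complex_expectation P (fun=> a) = a.
Proof.
rewrite complex_expectationE !Rintegral_cst //.
have -> : fine (P setT) = 1 by rewrite probability_setT.
by rewrite !mulr1; case: a.
Qed.

Lemma complex_integrable_sum (I : Type) (r : seq I) (F : I -> T -> R[i]) :
  (forall i, complex_integrable (F i)) ->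
  complex_integrable (fun t => \sum_(i <- r) F i t).
Proof.
move=> iF; elim: r => [|i r IH].
  apply: eq_complex_integrable (complex_integrable_cst 0) => t.
  by rewrite big_nil.
apply: eq_complex_integrable (complex_integrableD (iF i) IH) => t.
by rewrite big_cons.
Qed.

Lemma complex_expectation_sum (I : Type) (r : seq I) (F : I -> T -> R[i]) :
  (forall i, complex_integrable (F i)) ->
  complex_expectation P (fun t => \sum_(i <- r) F i t) =
  \sum_(i <- r) complex_expectation P (F i).
Proof.
move=> iF; elim: r => [|i r IH].
  rewrite [RHS]big_nil -[RHS](complex_expectation_cst 0).
  by apply: eq_complex_expectation => t; rewrite big_nil.
rewrite big_cons -IH -complex_expectationD //; last exact: complex_integrable_sum.
by apply: eq_complex_expectation => t; rewrite big_cons.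
Qed.

End ComplexExpectation.

Section ComplexIndependentProducts.
Local Open Scope classical_set_scope.
Context d (T : measurableType d) (R : realType) (P : probability T R).
Variables (J : finType) (S : {set J}) (X : J -> T -> R[i]).
Hypothesis mX : forall i, i \in S -> complex_rv (X i).
Hypothesis indep : mutually_independent P S X.

Local Notation Y i := (@pair_of_complex R \o X i).

Lemma prod_realC (I : finType) (A : {set I}) (r : I -> R) :
  \prod_(i in A) (r i)%:C = (\prod_(i in A) r i)%:C.
Proof. by rewrite rmorph_prod. Qed.

(** The simple class consists of nonnegative real functions, where the previous product formula
    applies. A general factor is a complex combination of four such functions, the positive and
    negative parts of its real and imaginary parts, and both sides are linear in each factor. *)
Lemma complex_expectation_prod_indep (F : J -> R * R -> R[i]) :
  (forall i, i \in S -> [/\ measurable_fun setT (fun x => complex.Re (F i x)),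
     measurable_fun setT (fun x => complex.Im (F i x))
     & complex_integrable P (fun t => F i (Y i t))]) ->
  complex_integrable P (fun t => \prod_(i in S) F i (Y i t)) /\
  complex_expectation P (fun t => \prod_(i in S) F i (Y i t)) =
   \prod_(i in S) complex_expectation P (fun t => F i (Y i t)).
Proof.
pose C0 (i : J) (f : R * R -> R[i]) := exists r : R * R -> R,
  [/\ measurable_fun setT r, forall x, (0 <= r x)%R,
   complex_integrable P (fun t => f (Y i t)) & forall x, f x = (r x)%:C].
pose C1 (i : J) (f : R * R -> R[i]) :=
  [/\ measurable_fun setT (fun x => complex.Re (f x)),
     measurable_fun setT (fun x => complex.Im (f x))
     & complex_integrable P (fun t => f (Y i t))].
move: F; apply: (coordinatewise_ind (C0 := C0) (C1 := C1)).
- move=> i f iS [r [mr r0 fi fr]]; split => //.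
    by under eq_fun do rewrite fr; exact: mr.
  by under eq_fun do rewrite fr; exact: measurable_cst.
- move=> F FC.
  have {}FC i : exists r : R * R -> R, i \in S ->
      [/\ measurable_fun setT r, forall x, (0 <= r x)%R,
        complex_integrable P (fun t => F i (Y i t)) & forall x, F i x = (r x)%:C].
    have [/FC [r Hr]|_] := boolP (i \in S); first by exists r.
    by exists (fun=> 0).
  have /choice [r Hr] := FC.
  have rint i : i \in S -> P.-integrable setT (fun t => (r i (Y i t))%:E).
    move=> /Hr [_ _ [h _] rE]; apply: eq_integrable h => // t _.
    by rewrite rE.
  have FE t : \prod_(i in S) F i (Y i t) = (\prod_(i in S) r i (Y i t))%:C.
    by rewrite -prod_realC; apply: eq_bigr => i /Hr [_ _ _ ->].
  have Er i : i \in S -> complex_expectation P (fun t => F i (Y i t)) =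
      (fine (\int[P]_t (r i (Y i t))%:E)%E)%:C.
    move=> /Hr [_ _ _ rE]; rewrite complex_expectationE.
    apply/eqP; rewrite eq_complex /=; apply/andP; split; apply/eqP.
      by apply: eq_Rintegral => t _; rewrite rE.
    transitivity (Rintegral P setT (fun=> 0 : R)).
      by apply: eq_Rintegral => t _; rewrite rE.
    by rewrite Rintegral_cst // mul0r.
  have rprod : (\int[P]_t (\prod_(i in S) r i (Y i t))%:E =
   (\prod_(i in S) fine (\int[P]_t (r i (Y i t))%:E))%:E)%E.
    apply: (ge0_integral_prod_indep mX indep) => i iS.
    have [mr r0 _ _] := Hr i iS; split => //.
    have /integrableP [_] := rint i iS.
    by under eq_integral do rewrite gee0_abs ?lee_fin //.
  have iprod : complex_integrable P (fun t => \prod_(i in S) F i (Y i t)).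
    apply: (@eq_complex_integrable _ _ _ _ (fun t => (\prod_(i in S) r i (Y i t))%:C)).
      by move=> t; rewrite FE.
    split; last exact: integrable0.
    apply/integrableP; split.
      apply/measurable_EFinP.
      have := measurable_prod_comp mX (F := r) xpredT.
      under eq_fun do under eq_bigl do rewrite andbT.
      by apply => i /Hr [].
    rewrite (eq_integral (fun t => (\prod_(i in S) r i (Y i t))%:E)).
      by rewrite rprod ltry.
    move=> t _ /=; rewrite ger0_norm // prodr_ge0 // => i /Hr [_ r0 _ _].
    exact: r0.
  split => //.
  rewrite (eq_bigr _ Er) prod_realC complex_expectationE.
  apply/eqP; rewrite eq_complex /=; apply/andP; split; apply/eqP.
    rewrite /Rintegral (eq_integral (fun t => (\prod_(i in S) r i (Y i t))%:E)).
      by rewrite rprod.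
    by move=> t _; rewrite FE.
  transitivity (Rintegral P setT (fun=> 0 : R)).
    by apply: eq_Rintegral => t _; rewrite FE.
  by rewrite Rintegral_cst // mul0r.
- move=> F i iS F1 step.
  have [mr mi Fint] := F1 i iS.
  pose v := \prod_(j in S | j != i) complex_expectation P (fun t => F j (Y j t)).
  pose V t := \prod_(j in S | j != i) F j (Y j t).
  have UE f t : \prod_(j in S) [eta F with i |-> f] j (Y j t) = f (Y i t) * V t.
    rewrite (bigD1 i) //= eqxx; congr (_ * _); apply: eq_bigr => j /andP[_ ji].
    by rewrite (negbTE ji).
  have aE f : \prod_(j in S) complex_expectation P (fun t => [eta F with i |-> f] j (Y j t))
      = complex_expectation P (fun t => f (Y i t)) * v.
    rewrite (bigD1 i) //= eqxx; congr (_ * _); apply: eq_bigr => j /andP[_ ji].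
    by rewrite (negbTE ji).
  have FE : F = [eta F with i |-> F i].
    by apply/funext => j /=; case: eqP => [->|].
  (* Factorisation in the [i]-th argument, together with the integrability that linearity needs;
     closed under sums and scalar multiples. *)
  pose good f := [/\ complex_integrable P (fun t => f (Y i t)),
     complex_integrable P (fun t => f (Y i t) * V t) &
     complex_expectation P (fun t => f (Y i t) * V t) =
     complex_expectation P (fun t => f (Y i t)) * v].
  have good0 f : C0 i f -> good f.
    move=> Cf; have [h1 h2] := step f Cf; case: (Cf) => r [_ _ fint _].
    split => //; first by apply: eq_complex_integrable h1 => t; rewrite UE.
    by rewrite -aE -h2; apply: eq_complex_expectation => t; rewrite UE.
  have goodD f g : good f -> good g -> good (fun x => f x + g x).
    move=> [f1 f2 f3] [g1 g2 g3]; split; first exact: complex_integrableD.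
      apply: eq_complex_integrable (complex_integrableD f2 g2) => t.
      by rewrite mulrDl.
    rewrite (@eq_complex_expectation _ _ _ _ _ (fun t => f (Y i t) * V t + g (Y i t) * V t)).
      by rewrite !complex_expectationD // f3 g3 mulrDl.
    by move=> t; rewrite mulrDl.
  have goodZ a f : good f -> good (fun x => a * f x).
    move=> [f1 f2 f3]; split; first exact: complex_integrableZ.
      apply: eq_complex_integrable (complex_integrableZ a f2) => t.
      by rewrite mulrA.
    rewrite (@eq_complex_expectation _ _ _ _ _ (fun t => a * (f (Y i t) * V t))).
      by rewrite !complex_expectationZ // f3 mulrA.
    by move=> t; rewrite mulrA.
  have [gi1 gi2 gi3] : good (F i).
    (* Positive part: [u] is [part u] minus [part] of its opposite. *)
    pose part (u : R * R -> R) (x : R * R) : R[i] := (Num.max (u x) 0)%:C.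
    have C0part u : measurable_fun setT u ->
        P.-integrable setT (fun t => (u (Y i t))%:E) -> C0 i (part u).
      move=> mu iu; exists (fun x => Num.max (u x) 0); split => //.
      - exact: measurable_maxr.
      - by move=> x; rewrite le_max lexx orbT.
      split; last exact: integrable0.
      apply: (eq_integrable measurableT _ _ _ (integrable_funepos measurableT iu)).
      by move=> t _; rewrite funeposE /= EFin_max.
    pose re x := complex.Re (F i x); pose im x := complex.Im (F i x).
    have FiE x : F i x = (part re x + -1 * part (fun y => - re y) x)
        + 'i * (part im x + -1 * part (fun y => - im y) x).
      have pE u : part u x + -1 * part (fun y => - u y) x = (u x)%:C.
        rewrite /part mulN1r -rmorphB /=; congr (_%:C).
        have [u0|/ltW u0] := leP 0 (u x).
          have u1 : - u x <= 0 by rewrite oppr_le0.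
          by rewrite (max_idPr u1) subr0.
        have u1 : 0 <= - u x by rewrite oppr_ge0.
        by rewrite (max_idPl u1) sub0r opprK.
      rewrite !pE; rewrite /re /im; case: (F i x) => a b /=.
      by apply/eqP; rewrite eq_complex /= !(mul0r, mul1r, mulr0, subr0, addr0, add0r) !eqxx.
    have /funext -> := FiE.
    have nint u : P.-integrable setT (fun t => (u (Y i t))%:E) ->
        P.-integrable setT (fun t => (- u (Y i t))%:E).
      by move=> /integrableN.
    have gpart u : measurable_fun setT u ->
        P.-integrable setT (fun t => (u (Y i t))%:E) ->
        good (fun x => part u x + -1 * part (fun y => - u y) x).
      move=> mu iu; apply: goodD; first by apply/good0/C0part.
      apply/goodZ/good0/C0part; first exact: measurableT_comp.
      exact: nint.
    case: Fint => Fr Fi.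
    by apply: goodD; [exact: gpart|apply: goodZ; exact: gpart].
  rewrite FE; split.
    by apply: eq_complex_integrable gi2 => t; rewrite UE.
  by rewrite aE -gi3; apply: eq_complex_expectation => t; rewrite UE.
Qed.

End ComplexIndependentProducts.

(** * Transfer of expectations along equality in law *)

Section SameLaw.
Local Open Scope classical_set_scope.
Context d (T : measurableType d) (R : realType) (P : probability T R).
Context d' (T' : measurableType d') (P' : probability T' R).
Variables (X : T -> R[i]) (Y : T' -> R[i]).
Hypotheses (mX : complex_rv X) (mY : complex_rv Y) (XY : same_law P P' X Y).

Local Notation pX := (@pair_of_complex R \o X).
Local Notation pY := (@pair_of_complex R \o Y).

(** Equality in law is equality of the image measures on [R * R]; both expectations are compared
    through these. *)
Lemma same_law_pushforward (f : R * R -> \bar R) :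
  (\int[pushforward P pX]_x f x = \int[pushforward P' pY]_x f x)%E.
Proof. by apply: eq_measure_integral => B mB _; exact: XY. Qed.

Lemma same_law_integrable (r : R * R -> R) : measurable_fun setT r ->
  P'.-integrable setT (fun t => (r (pY t))%:E) ->
  P.-integrable setT (fun t => (r (pX t))%:E).
Proof.
move=> mr /integrableP [_ fin]; apply/integrableP; split.
  apply/measurable_EFinP; exact: measurableT_comp mX.
have mabs : measurable_fun setT (fun x => `|(r x)%:E|%E).
  by apply: measurableT_comp => //; exact/measurable_EFinP.
have abs0 : {in setT, forall x : R * R, (0 <= `|(r x)%:E|)%E} by move=> x _.
have := ge0_integral_pushforward mX P measurableT mabs abs0.
rewrite preimage_setT /= => <-; rewrite same_law_pushforward.
by rewrite (ge0_integral_pushforward mY P' measurableT mabs abs0).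
Qed.

Lemma same_law_Rintegral (r : R * R -> R) : measurable_fun setT r ->
  P'.-integrable setT (fun t => (r (pY t))%:E) ->
  Rintegral P setT (fun t => r (pX t)) = Rintegral P' setT (fun t => r (pY t)).
Proof.
move=> mr iY; have iX := same_law_integrable mr iY; congr fine.
have mEr : measurable_fun setT (EFin \o r) by exact/measurable_EFinP.
have := @integral_pushforward _ _ _ _ R _ mX P setT _ mEr.
rewrite preimage_setT => /(_ iX measurableT) /= <-.
rewrite same_law_pushforward.
by rewrite (@integral_pushforward _ _ _ _ R _ mY P' setT _ mEr).
Qed.

Lemma same_law_complex_expectation (f : R * R -> R[i]) :
  measurable_fun setT (fun x => complex.Re (f x)) ->
  measurable_fun setT (fun x => complex.Im (f x)) ->
  complex_integrable P' (fun t => f (pY t)) ->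
  complex_integrable P (fun t => f (pX t)) /\
  complex_expectation P (fun t => f (pX t)) =
  complex_expectation P' (fun t => f (pY t)).
Proof.
move=> mr mi [ir ii]; split.
  by split; [exact: (same_law_integrable mr)|exact: (same_law_integrable mi)].
by rewrite !complex_expectationE (same_law_Rintegral mr) // (same_law_Rintegral mi).
Qed.

End SameLaw.

(** * Complex numbers and moments of the data symbol *)

Section ComplexModulus.
Variable R : realType.
Implicit Types x y : R[i].

Lemma normc_ge0 (x : R[i]) : 0 <= normc x.
Proof. by case: x => a b; rewrite sqrtr_ge0. Qed.

Lemma normcX (x : R[i]) n : normc (x ^+ n) = normc x ^+ n.
Proof. by elim: n => [|n IH]; [rewrite normc1|rewrite !exprS normcM IH]. Qed.

Lemma normc_conjc (x : R[i]) : normc (conjc x) = normc x.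
Proof. by case: x => a b; rewrite /= sqrrN. Qed.

Lemma Re_le_normc (x : R[i]) : `|complex.Re x| <= normc x.
Proof.
case: x => a b /=; rewrite -sqrtr_sqr ler_sqrt ?lerDl ?sqr_ge0 //.
by rewrite addr_ge0 ?sqr_ge0.
Qed.

Lemma Im_le_normc (x : R[i]) : `|complex.Im x| <= normc x.
Proof.
case: x => a b /=; rewrite -sqrtr_sqr ler_sqrt ?lerDr ?sqr_ge0 //.
by rewrite addr_ge0 ?sqr_ge0.
Qed.

Lemma mulr_conjc (x : R[i]) : x * conjc x = (normc x ^+ 2)%:C.
Proof.
case: x => a b; rewrite /= sqr_sqrtr ?addr_ge0 ?sqr_ge0 //.
by apply/eqP; rewrite eq_complex /= !mulrN opprK !expr2 (mulrC b a) addNr !eqxx.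
Qed.

Lemma conjcM (x y : R[i]) : conjc (x * y) = conjc x * conjc y.
Proof. exact: rmorphM. Qed.

Lemma conjc_sum (I : Type) (r : seq I) (F : I -> R[i]) :
  conjc (\sum_(i <- r) F i) = \sum_(i <- r) conjc (F i).
Proof. exact: rmorph_sum. Qed.

Lemma norm_normc (x : R[i]) : `|x| = (normc x)%:C.
Proof. by rewrite normc_def; case: x. Qed.

Lemma normc_sum_le (J : Type) (r : seq J) (F : J -> R[i]) :
  normc (\sum_(j <- r) F j) <= \sum_(j <- r) normc (F j).
Proof.
elim: r => [|j r IH]; first by rewrite !big_nil normc0.
by rewrite !big_cons (le_trans (le_normcD _ _)) // lerD2l.
Qed.

End ComplexModulus.

(** Split at [x = 1]. The bound lets the single integrable function 1 + |d|^4 dominate every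
    monomial of degree at most 4. *)
Lemma exprn_le_1D (R : realType) (x : R) m n :
  0 <= x -> (m <= n)%N -> x ^+ m <= 1 + x ^+ n.
Proof.
move=> x0 mn; have [x1|/ltW x1] := leP x 1.
  by rewrite (le_trans (exprn_ile1 m x0 x1)) // lerDl exprn_ge0.
by rewrite (le_trans (ler_weXn2l x1 mn)) // lerDr.
Qed.

Section Monomials.
Local Open Scope classical_set_scope.
Variable R : realType.

(** This is z^a times the conjugate of z^b in real coordinates: a function on [R * R], where
    measurability and equality in law are expressed. *)
Definition monomial (a b : nat) (x : R * R) : R[i] :=
  (x.1 +i* x.2) ^+ a * (x.1 -i* x.2) ^+ b.

Lemma monomial_pair a b (z : R[i]) :
  monomial a b (pair_of_complex z) = z ^+ a * conjc z ^+ b.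
Proof. by case: z. Qed.

Definition complex_measurable (f : R * R -> R[i]) :=
  measurable_fun setT (fun x => complex.Re (f x)) /\
  measurable_fun setT (fun x => complex.Im (f x)).

Lemma complex_measurableM f g : complex_measurable f -> complex_measurable g ->
  complex_measurable (fun x => f x * g x).
Proof.
move=> [fr fi] [gr gi]; split.
  rewrite (_ : (fun x => _) = (fun x => complex.Re (f x) * complex.Re (g x) -
    complex.Im (f x) * complex.Im (g x))).
    by apply: measurable_funB; exact: measurable_funM.
  by apply/funext => x; case: (f x); case: (g x).
rewrite (_ : (fun x => _) = (fun x => complex.Re (f x) * complex.Im (g x) +
  complex.Im (f x) * complex.Re (g x))).
  by apply: measurable_funD; exact: measurable_funM.
by apply/funext => x; case: (f x); case: (g x).
Qed.

Lemma complex_measurableX f n : complex_measurable f ->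
  complex_measurable (fun x => f x ^+ n).
Proof.
move=> mf; elim: n => [|n IH].
  by split; [exact: measurable_cst|exact: measurable_cst].
by rewrite (_ : (fun x => _) = (fun x => f x * f x ^+ n));
  [exact: complex_measurableM|apply/funext => x; rewrite exprS].
Qed.

Lemma complex_measurable_monomial a b : complex_measurable (monomial a b).
Proof.
apply: complex_measurableM; apply: complex_measurableX.
  split; [exact: measurable_fst|exact: measurable_snd].
split; [exact: measurable_fst|].
by apply: measurableT_comp measurable_snd.
Qed.

End Monomials.

Section Moments.
Local Open Scope classical_set_scope.
Context d (T : measurableType d) (R : realType) (P : probability T R).
Variable (D : T -> R[i]).
Hypothesis hD : data_symbol P D.

Lemma complex_integrable_monomial a b : (a + b <= 4)%N ->
  complex_integrable P (fun t => monomial a b (pair_of_complex (D t))).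
Proof.
move=> ab; have [mr mi] := complex_measurable_monomial R a b.
have mD := data_symbol_rv hD.
have mN : measurable_fun setT (fun t => normc (D t) ^+ 4).
  (* The fourth power of the modulus is itself a monomial, hence measurable. *)
  rewrite (_ : (fun t => _) = (fun t => complex.Re (monomial 2 2 (pair_of_complex (D t))))).
    have [m22 _] := complex_measurable_monomial R 2 2.
    exact: measurableT_comp m22 mD.
  apply/funext => t; rewrite monomial_pair -exprMn mulr_conjc -rmorphXn /=.
  by rewrite -exprM.
have iN : P.-integrable setT (fun t => (1 + normc (D t) ^+ 4)%:E).
  apply: (@eq_integrable _ _ _ _ _ measurableT
    ((fun=> 1%:E) \+ (fun t => (normc (D t) ^+ 4)%:E))%E) => //.
  apply: integrableD => //; first exact: finite_measure_integrable_cst.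
  apply/integrableP; split; first exact/measurable_EFinP.
  rewrite (eq_integral (fun t => (normc (D t) ^+ 4)%:E)) => [|t _].
    by have := data_symbol_moment4 hD; rewrite unlock.
  by rewrite gee0_abs ?lee_fin ?exprn_ge0 ?normc_ge0.
have bound t : normc (monomial a b (pair_of_complex (D t))) <= 1 + normc (D t) ^+ 4.
  rewrite monomial_pair normcM !normcX normc_conjc -exprD.
  by apply: exprn_le_1D => //; exact: normc_ge0.
have b0 t : 0 <= 1 + normc (D t) ^+ 4.
  by rewrite addr_ge0 // exprn_ge0 // normc_ge0.
split; apply: (le_integrable measurableT _ _ iN).
- by apply/measurable_EFinP; exact: measurableT_comp mr mD.
- move=> t _ /=; rewrite lee_fin [leRHS]ger0_norm //.
  exact: le_trans (Re_le_normc _) (bound t).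
- by apply/measurable_EFinP; exact: measurableT_comp mi mD.
- move=> t _ /=; rewrite lee_fin [leRHS]ger0_norm //.
  exact: le_trans (Im_le_normc _) (bound t).
Qed.

Definition moment (a b : nat) : R[i] :=
  complex_expectation P (fun t => D t ^+ a * conjc (D t) ^+ b).

Lemma complex_expectation_conjc f : complex_integrable P f ->
  complex_expectation P (fun t => conjc (f t)) = conjc (complex_expectation P f).
Proof.
move=> [fr fi]; rewrite !complex_expectationE /=.
apply/eqP; rewrite eq_complex /=; apply/andP; split; apply/eqP.
  by apply: eq_Rintegral => t _; case: (f t).
rewrite -mulN1r -RintegralZl //.
by apply: eq_Rintegral => t _; rewrite mulN1r; case: (f t).
Qed.

Lemma momentE a b :
  moment a b = complex_expectation P (fun t => monomial a b (pair_of_complex (D t))).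
Proof. by apply: eq_complex_expectation => t; rewrite monomial_pair. Qed.

Lemma momentC a b : (a + b <= 4)%N -> moment b a = conjc (moment a b).
Proof.
move=> ab; rewrite (momentE a b) -complex_expectation_conjc.
  apply: eq_complex_expectation => t.
  by rewrite monomial_pair rmorphM !rmorphXn /= conjcK mulrC.
exact: complex_integrable_monomial.
Qed.

Lemma moment00 : moment 0 0 = 1.
Proof.
rewrite -[RHS](complex_expectation_cst P 1).
by apply: eq_complex_expectation => t; rewrite !expr0 mulr1.
Qed.

Lemma moment10 : moment 1 0 = 0.
Proof.
rewrite -(data_symbol_mean hD).
by apply: eq_complex_expectation => t; rewrite expr1 expr0 mulr1.
Qed.

Lemma moment20 : moment 2 0 = 0.
Proof.
rewrite -(data_symbol_pseudo hD).
by apply: eq_complex_expectation => t; rewrite expr0 mulr1.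
Qed.

Lemma moment_diag n : moment n n =
  (fine ('E_P[fun t => (normc (D t) ^+ (2 * n))%R])%E)%:C.
Proof.
have E t : D t ^+ n * conjc (D t) ^+ n = (normc (D t) ^+ (2 * n))%:C.
  by rewrite -exprMn mulr_conjc -rmorphXn /= exprM.
rewrite /moment complex_expectationE unlock.
apply/eqP; rewrite eq_complex /=; apply/andP; split; apply/eqP.
  by apply: eq_Rintegral => t _; rewrite E.
transitivity (Rintegral P setT (fun=> 0 : R)).
  by apply: eq_Rintegral => t _; rewrite E.
by rewrite Rintegral_cst // mul0r.
Qed.

Lemma moment11 : moment 1 1 = 1.
Proof. by rewrite moment_diag (data_symbol_power hD). Qed.

Lemma moment22 : moment 2 2 = (kurtosis P D)%:C.
Proof. exact: moment_diag. Qed.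

Lemma moment01 : moment 0 1 = 0.
Proof. by rewrite (momentC (a := 1)) // moment10 conjc0. Qed.

Lemma moment02 : moment 0 2 = 0.
Proof. by rewrite (momentC (a := 2)) // moment20 conjc0. Qed.

End Moments.

(** * Roots of unity and the ambiguity function *)

Section Cis.
Variable R : realType.
Implicit Types (s t : R).

Lemma cis0 : cis (0 : R) = 1.
Proof. by rewrite /cis cos0 sin0. Qed.

Lemma cisD s t : cis (s + t) = cis s * cis t.
Proof.
rewrite /cis cosD sinD; apply/eqP; rewrite eq_complex /= eqxx /=.
by rewrite addrC [cos s * _]mulrC mulrC [sin s * _]mulrC eqxx.
Qed.

Lemma cisN t : cis (- t) = conjc (cis t).
Proof. by rewrite /cis cosN sinN. Qed.

Lemma normc_cis t : normc (cis t) = 1.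
Proof. by rewrite /= cos2Dsin2 sqrtr1. Qed.

Lemma cis_neq0 t : cis t != 0.
Proof.
apply/eqP => h; have := normc_cis t.
by rewrite h normc0 => /eqP; rewrite eq_sym oner_eq0.
Qed.

Lemma cisX t n : cis t ^+ n = cis (t * n%:R).
Proof.
elim: n => [|n IH]; first by rewrite mulr0 cis0.
by rewrite exprS IH -cisD; congr cis; rewrite -natr1 mulrDr mulr1 addrC.
Qed.

Lemma cisV t : (cis t)^-1 = cis (- t).
Proof. by apply: (mulfI (cis_neq0 t)); rewrite mulfV ?cis_neq0 // -cisD subrr cis0. Qed.

Lemma conjc_cis t : conjc (cis t) = (cis t)^-1.
Proof. by rewrite cisV cisN. Qed.

Lemma cis_2pi : cis (2 * pi : R) = 1.
Proof. by rewrite mulr_natl /cis cos2pi sin2pi. Qed.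

Lemma cis_2piz (z : int) : cis (2 * pi * z%:~R : R) = 1.
Proof.
have cisn n : cis (2 * pi * n%:R : R) = 1 by rewrite -cisX cis_2pi expr1n.
case: z => n; first exact: cisn.
by rewrite NegzE mulrNz mulrN -cisV cisn invr1.
Qed.

(** If cos t = 1, the double angle formula forces sin (t / 2) = 0, whereas t / 2 lies strictly
    between 0 and pi. *)
Lemma cis_neq1 t : 0 < t < 2 * pi -> cis t != 1.
Proof.
move=> /andP[t0 t2]; apply/eqP => -[cos1 _].
have := @sin_gt0_pi _ (t / 2); rewrite divr_gt0 // ltr_pdivrMr // mulrC t2.
move=> /(_ isT) s0.
have : cos (t / 2 + t / 2) = 1 by rewrite -splitr.
rewrite cosD -!expr2; have := cos2Dsin2 (t / 2) => h1 h2.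
have h3 : 0 < sin (t / 2) ^+ 2 by rewrite exprn_gt0.
by lra.
Qed.

(** Whole turns drop out, so [x] may be replaced by its remainder modulo [L]; a nonzero remainder
    gives an angle strictly between 0 and 2 pi. *)
Lemma cis_int_eq1 (L : nat) (x : int) : (0 < L)%N ->
  (cis (2 * pi * x%:~R / L%:R : R) == 1) = (L%:Z %| x)%Z.
Proof.
move=> L0; have L0' : (L%:R : R) != 0 by rewrite pnatr_eq0 -lt0n.
rewrite {1}(divz_eq x L) intrD intrM.
have -> : 2 * pi * ((x %/ L)%Z%:~R * L%:~R + (x %% L)%Z%:~R) / L%:R =
    2 * pi * (x %/ L)%Z%:~R + 2 * pi * (x %% L)%Z%:~R / L%:R :> R.
  by field.
rewrite cisD cis_2piz mul1r.
have [r0|r0] := eqVneq (x %% L)%Z 0.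
  by rewrite r0 mulr0 mul0r cis0 eqxx; apply/esym/dvdz_mod0P.
rewrite (negbTE (cis_neq1 _)); last first.
  have rge : 0 < (x %% L)%Z%:~R :> R by rewrite ltr0z lt_neqAle eq_sym r0 modz_ge0 // -lt0n.
  have rlt : (x %% L)%Z%:~R < L%:R :> R by rewrite -[L%:R]/(L%:~R) ltr_int ltz_pmod.
  have L1 : 0 < L%:R :> R by rewrite ltr0n.
  have pi0 := pi_gt0 R.
  rewrite divr_gt0 ?mulr_gt0 //= ltr_pdivrMr //.
  by rewrite ltr_pM2l // mulr_gt0.
by apply/esym/negbTE/negP => /dvdz_mod0P h; case/eqP: r0.
Qed.

Definition omega (N : nat) : R[i] := cis (2 * pi / N%:R).

Lemma omegaX N m : omega N ^+ m = cis (2 * pi * m%:R / N%:R).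
Proof. by rewrite cisX mulrAC. Qed.

Lemma omega_prim N : (0 < N)%N -> N.-primitive_root (omega N).
Proof.
move=> N0; apply/andP; split => //; apply/forallP => i.
rewrite unity_rootE omegaX (cis_int_eq1 i.+1%:Z N0) /dvdz /=; apply/eqP.
apply/idP/eqP => [/dvdn_leq Ni|->]; last exact: dvdnn.
by apply/eqP; rewrite eqn_leq ltn_ord Ni.
Qed.

(** Geometric series: z - 1 times the sum is z^L - 1 = 0. All orthogonality relations below come
    from this. *)
Lemma sum_expr_unity (L : nat) (z : R[i]) : z ^+ L = 1 ->
  \sum_(l < L) z ^+ l = if z == 1 then L%:R else 0.
Proof.
move=> zL; have [->|z1] := eqVneq z 1.
  by under eq_bigr do rewrite expr1n; rewrite sumr_const card_ord.
have := subrX1 z L; rewrite zL subrr => /esym/eqP.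
by rewrite mulf_eq0 subr_eq0 (negbTE z1) /= => /eqP.
Qed.

End Cis.

Section CyclicIndices.
Variable N : nat.
Implicit Types (n q i : 'I_N) (s t : nat).

Lemma ord_pos n : (0 < N)%N.
Proof. exact: leq_ltn_trans (leq0n n) (ltn_ord n). Qed.

Lemma addmod0 n : addmod n 0 = n.
Proof. by apply: val_inj; rewrite /= addn0 modn_small. Qed.

Lemma addmodD n s t : addmod (addmod n s) t = addmod n (s + t).
Proof. by apply: val_inj; rewrite /= modnDml addnA. Qed.

Lemma addmodDN n s t : addmod n (s + N * t) = addmod n s.
Proof. by apply: val_inj; rewrite /= addnA addnC mulnC modnMDl. Qed.

Lemma addmodN n : addmod n N = n.
Proof. by apply: val_inj; rewrite /= modnDr modn_small. Qed.

Lemma addmodK q : cancel (fun n => addmod n q) (fun n => submod n q).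
Proof.
move=> n; rewrite /submod addmodD subnKC; last exact: ltnW.
by rewrite addmodN.
Qed.

Lemma submodK q : cancel (fun n => submod n q) (fun n => addmod n q).
Proof.
move=> n; rewrite /submod addmodD subnK; last exact: ltnW.
by rewrite addmodN.
Qed.

Lemma submod_inj n : injective (fun q : 'I_N => submod n q).
Proof.
move=> q q' e; apply: val_inj.
have := submodK q' n; rewrite -e -[RHS](submodK q n) => /(congr1 val) /= /eqP.
by rewrite eqn_modDl !modn_small // => /eqP.
Qed.

Lemma submod_fixed n q : submod n q = n -> (q : nat) = 0%N.
Proof.
move=> e; have := submodK q n; rewrite e => /(congr1 val) /= /eqP.
rewrite -[X in _ == X](modn_small (ltn_ord n)) -[X in _ == X %[mod _]]addn0 eqn_modDl.
by rewrite mod0n modn_small // => /eqP.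
Qed.

Lemma addmod_eq n s t : (addmod n s == addmod n t) = (s == t %[mod N]).
Proof. by rewrite -val_eqE /= eqn_modDl. Qed.

End CyclicIndices.

(** * The ambiguity function in terms of the symbols *)

Section Ambiguity.
Variables (R : realType) (N : nat).
Local Notation w := (omega R N).
Implicit Types (k q n : 'I_N) (s : 'I_N -> R[i]).

(** Symbol-domain form of the DP-AF, with delay and Doppler exchanged by the DFT; on the pilot
    vector it is the sum inside [g]. *)
Definition ambiguity s k q : R[i] :=
  \sum_(n < N) s n * conjc (s (submod n q)) * w ^+ (n * k).

Lemma omega_addmod n t : w ^+ addmod n t = w ^+ n * w ^+ t.
Proof.
by rewrite -exprD (prim_expr_mod (omega_prim R (ord_pos n))).
Qed.

Lemma omega_neq0 : w != 0. Proof. exact: cis_neq0. Qed.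

Lemma omegaN n : w ^+ N = 1.
Proof. exact: prim_expr_order (omega_prim R (ord_pos n)). Qed.

Lemma omega_submod n q : w ^+ submod n q = w ^+ n / w ^+ q.
Proof.
apply: (mulIf (expf_neq0 q omega_neq0)).
by rewrite divfK ?expf_neq0 ?omega_neq0 // -omega_addmod submodK.
Qed.

Lemma conjc_omega m : conjc (w ^+ m) = (w ^+ m)^-1.
Proof.
transitivity (conjc w ^+ m); first exact: rmorphXn.
by rewrite (conjc_cis _ : conjc w = w^-1) exprVn.
Qed.

Lemma conjc_omegaV m : conjc (w ^+ m)^-1 = w ^+ m.
Proof. by rewrite -[RHS]conjcK conjc_omega. Qed.

Lemma normc_omega m : normc (w ^+ m) = 1.
Proof. by rewrite normcX normc_cis expr1n. Qed.

Lemma g_ambiguity (I : {set 'I_N}) (c : 'I_N -> R[i]) k q :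
  g I c k q = normc (ambiguity (pilot I c) k q) ^+ 2.
Proof.
rewrite /g /ambiguity; congr (normc _ ^+ 2); apply: eq_bigr => n _.
by rewrite omegaX.
Qed.

(** After the DFT the delay [k] acts as a modulation and the Doppler shift [q] as a translation by
    [q]. The two sides agree up to a unimodular factor, so only the moduli are compared. *)
Lemma dpaf_ofdm (s : 'cV[R[i]]_N) k q :
  normc (dpaf (ofdm s) k q) = normc (ambiguity (fun i => s i 0) k q).
Proof.
have N0 := ord_pos k.
have NR0 : (N%:R : R[i]) != 0 by rewrite pnatr_eq0 -lt0n.
pose c : R[i] := ((Num.sqrt N%:R)^-1)%:C.
have cR : conjc c = c by exact: conjc_real.
have cc : c * c = N%:R^-1.
  rewrite -rmorphM -invfM -expr2 sqr_sqrtr ?ler0n //.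
  by rewrite fmorphV rmorph_nat.
have xE m : ofdm s m 0 = c * \sum_(a < N) w ^+ (m * a) * s a 0.
  rewrite mxE mulr_sumr; apply: eq_bigr => a _; rewrite !mxE mulrA.
  congr (_ * _); rewrite -/c omegaX mulnC.
  by rewrite conjcM cR cisN conjcK.
have -> : dpaf (ofdm s) k q = \sum_(m < N)
    conjc (ofdm s (submod m k) 0) * conjc (w ^+ (q * m)) * ofdm s m 0.
  rewrite /dpaf mxE; apply: eq_bigr => m _; congr (_ * _).
  have hE n : Defs.hermitian (ofdm s) 0 n = conjc (ofdm s n 0).
    by rewrite [LHS]mxE [X in conjc X]mxE.
  have sE n : (cyclic_shift R k)^T n m = (n == submod m k)%:R by rewrite !mxE.
  rewrite map_diag_mx mul_mx_diag mxE; congr (_ * _); last by rewrite !mxE omegaX.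
  rewrite mxE (bigD1 (submod m k)) //= hE sE eqxx mulr1 big1 ?addr0 // => n nk.
  by rewrite sE (negbTE nk) mulr0.
(* Both time samples are expanded in the symbols; the sum over time becomes geometric and will
   select [b = a + q] modulo [N]. *)
have -> : \sum_(m < N)
    conjc (ofdm s (submod m k) 0) * conjc (w ^+ (q * m)) * ofdm s m 0 =
  \sum_(a < N) \sum_(b < N) (N%:R^-1 * (conjc (s a 0) * s b 0 * w ^+ (a * k))) *
     \sum_(m < N) (w ^+ b / w ^+ a / w ^+ q) ^+ m.
  transitivity (\sum_(m < N) \sum_(a < N) \sum_(b < N)
      (N%:R^-1 * (conjc (s a 0) * s b 0 * w ^+ (a * k))) *
      (w ^+ b / w ^+ a / w ^+ q) ^+ m); last first.
    rewrite exchange_big; apply: eq_bigr => a _.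
    by rewrite exchange_big; apply: eq_bigr => b _; rewrite mulr_sumr.
  apply: eq_bigr => m _; rewrite !xE conjcM cR conjc_sum -cc.
  rewrite mulr_sumr !mulr_suml; apply: eq_bigr => a _.
  rewrite !mulr_sumr; apply: eq_bigr => b _.
  rewrite conjcM exprM omega_submod expr_div_n -!exprM conjcM conjc_omega.
  rewrite conjc_omegaV conjc_omega !expr_div_n -!exprM.
  rewrite (mulnC m a) (mulnC k a) (mulnC m b).
  have w1 := expf_neq0 (a * m) omega_neq0.
  have w2 := expf_neq0 (q * m) omega_neq0.
  move: (_ ^- (a * m)) (_ ^- (q * m)) (_ ^+ (a * k)) (_ ^+ (b * m)) => z1 z2 z3 z4; ring.
have yN (a b : 'I_N) : (w ^+ b / w ^+ a / w ^+ q) ^+ N = 1.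
  by rewrite !expr_div_n -!exprM ![(_ * N)%N]mulnC !exprM (omegaN k) !expr1n !divr1.
have yE (a b : 'I_N) : (w ^+ b / w ^+ a / w ^+ q == 1) = (b == addmod a q).
  have w1 := expf_neq0 a omega_neq0; have w2 := expf_neq0 q omega_neq0.
  rewrite -(inj_eq (mulIf w2)) mul1r divfK // -(inj_eq (mulIf w1)) divfK //.
  rewrite -omega_addmod (_ : addmod q a = addmod a q); last first.
    by apply: val_inj; rewrite /= addnC.
  by rewrite (eq_prim_root_expr (omega_prim R N0)) !modn_small.
rewrite (eq_bigr (fun a : 'I_N => conjc (s a 0) * s (addmod a q) 0 *
  w ^+ (a * k))); last first.
  move=> a _; move: (yE a); move: (addmod a q) => z yaE.
  rewrite (bigD1 z) //= [X in _ + X]big1 ?addr0 => [|b ba].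
    rewrite sum_expr_unity // yaE eqxx; field.
    exact: NR0.
  by rewrite sum_expr_unity // yaE (negbTE ba) mulr0.
(* The inserted unimodular factor is the one produced by the substitution a = n - q, written as a =
   n + (N - q). *)
rewrite -[RHS]mul1r -(normc_omega (k * (N - q))) -normcM; congr normc.
rewrite mulr_sumr (reindex (fun n => submod n q)) /=; last first.
  by exists (fun n => addmod n q) => n _; [exact: submodK|exact: addmodK].
apply: eq_bigr => n _.
rewrite submodK exprM omega_addmod exprMn -!exprM (mulnC (N - q)%N); ring.
Qed.

(** Expand the squared modulus and sum over [k] first: by orthogonality only the diagonal terms
    survive. *)
Lemma parseval (a : 'I_N -> R[i]) :
  \sum_(k < N) normc (\sum_(n < N) a n * w ^+ (n * k)) ^+ 2 =
  N%:R * \sum_(n < N) normc (a n) ^+ 2.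
Proof.
have [N0|N0] := posnP N.
  by rewrite !big1 ?mulr0 // => n _; exfalso; have := ord_pos n; rewrite N0.
apply: (@complexI R); rewrite rmorphM !rmorph_sum /= rmorph_nat.
transitivity (\sum_(n < N) \sum_(m < N) (a n * conjc (a m)) *
    \sum_(k < N) (w ^+ n / w ^+ m) ^+ k).
  rewrite (eq_bigr (fun k : 'I_N => \sum_(n < N) \sum_(m < N) (a n * conjc (a m)) *
      (w ^+ n / w ^+ m) ^+ k)).
    rewrite exchange_big; apply: eq_bigr => n _.
    by rewrite exchange_big; apply: eq_bigr => m _; rewrite mulr_sumr.
  move=> k _; rewrite -mulr_conjc rmorph_sum /= mulr_suml; apply: eq_bigr => n _.
  rewrite mulr_sumr; apply: eq_bigr => m _.
  rewrite rmorphM /= conjc_omega expr_div_n -!exprM; ring.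
rewrite mulr_sumr; apply: eq_bigr => n _.
rewrite (bigD1 n) //= divff ?expf_neq0 ?omega_neq0 // [X in _ + X]big1 ?addr0 => [|m mn].
  rewrite sum_expr_unity ?expr1n // eqxx mulr_conjc mulrC; congr (_ * _).
rewrite sum_expr_unity; last first.
  by rewrite expr_div_n -!exprM ![(_ * N)%N]mulnC !exprM omegaN // !expr1n divr1.
rewrite (negbTE (_ : _ != 1)) ?mulr0 //.
apply: contra mn => /eqP h; have : w ^+ n = w ^+ m.
  by rewrite -[LHS](divfK (expf_neq0 m omega_neq0)) h mul1r.
move/eqP; rewrite (eq_prim_root_expr (omega_prim R N0)) !modn_small // => /eqP nm.
by apply/eqP/val_inj.
Qed.

End Ambiguity.

(** * Counting extremal sidelobes *)

Section BoundedSums.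
Variables (R : realFieldType) (K : finType) (G : K -> R) (M : R).
Hypotheses (G0 : forall k, 0 <= G k) (GM : forall k, G k <= M).

Lemma natr_cardC (Z : {set K}) : #|K|%:R - #|Z|%:R = #|~: Z|%:R :> R.
Proof. by rewrite -(cardsC Z) natrD addrC addKr. Qed.

Lemma card_max_le_sum : #|[set k | G k == M]|%:R * M <= \sum_k G k.
Proof.
rewrite mulr_natl -sumr_const (bigID (fun k => G k == M) predT) /= ler_wpDr ?sumr_ge0 //.
rewrite big_mkcond [leRHS]big_mkcond /=; apply: ler_sum => k _.
by rewrite inE; case: eqP => [->|].
Qed.

(** Only the nonzero terms contribute, each at most [M]; this turns a lower bound on the sum into an
    upper bound on the number of zeros. *)
Lemma sum_le_card_neq0 : \sum_k G k <= (#|K|%:R - #|[set k | G k == 0]|%:R) * M.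
Proof.
rewrite natr_cardC mulr_natl -sumr_const.
rewrite [leRHS]big_mkcond /=; apply: ler_sum => k _.
by rewrite !inE; case: eqP => [->|].
Qed.

(** Equality case: the nonnegative gaps between terms and their bounds add up to 0, so each gap is
    0. *)
Lemma sum_eq_card_neq0 k :
  \sum_k G k = (#|K|%:R - #|[set k | G k == 0]|%:R) * M -> G k != 0 -> G k = M.
Proof.
rewrite natr_cardC mulr_natl -sumr_const.
rewrite [RHS]big_mkcond /= => /eqP; rewrite eq_sym -subr_eq0 -sumrB psumr_eq0.
  move=> /allP /(_ k (mem_index_enum k)) /=; rewrite !inE.
  by case: (G k =P 0) => //= _; rewrite subr_eq0 => /eqP.
by move=> j _; rewrite !inE subr_ge0; case: eqP => [->|].
Qed.

End BoundedSums.

Section ConstantBound.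
Variables (R : realFieldType) (K : finType) (G : K -> R) (M : R) (A : {set K}).
Hypothesis GM : forall k, k \in A -> G k <= M.

Lemma sum_le_const : \sum_(k in A) G k <= M * #|A|%:R.
Proof. by rewrite mulr_natr -sumr_const; apply: ler_sum. Qed.

Lemma sum_eq_const k : \sum_(k in A) G k = M * #|A|%:R -> k \in A -> G k = M.
Proof.
rewrite mulr_natr -sumr_const => /eqP; rewrite eq_sym -subr_eq0 -sumrB psumr_eq0.
  move=> /allP /(_ k (mem_index_enum k)) /= + kA; rewrite kA /=.
  by rewrite subr_eq0 => /eqP.
by move=> j jA; rewrite subr_ge0 GM.
Qed.

End ConstantBound.

Section Bounds.
Variables (R : realType) (N : nat) (I : {set 'I_N}) (c : 'I_N -> R[i]).
Hypothesis hc : forall i : 'I_N, i \in I -> normc (c i) = 1.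
Local Notation L := #|I|.
Local Notation w := (omega R N).
Implicit Types (k q n : 'I_N).

Lemma h_card q : h I q = #|[set n in I | submod n q \in I]|.
Proof.
rewrite /h -sum1_card [RHS]big_mkcond /=; apply: eq_bigr => n _.
by rewrite inE /pilot_mask; case: (n \in I); case: (_ \in I).
Qed.

(** [h] counts the pilots whose translate by -q is again a pilot, so the value [L] means that every
    pilot qualifies. *)
Lemma DsetP q : reflect ((q : nat) <> 0%N /\ forall n, n \in I -> submod n q \in I)
  (q \in Dset I).
Proof.
rewrite inE h_card; apply: (iffP andP) => -[q0 hq]; split.
- exact/eqP.
- move=> n nI; suff : n \in [set n in I | submod n q \in I] by rewrite inE nI.
  suff -> : [set n in I | submod n q \in I] = I by [].
  apply/eqP; rewrite eqEcard (eqP hq) leqnn andbT.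
  by apply/fintype.subsetP => m; rewrite inE => /andP[].
- exact/eqP.
- apply/eqP; congr #|pred_of_set _|; apply/setP => n; rewrite inE.
  by case nI: (n \in I) => //=; rewrite hq.
Qed.

Lemma pilot_term n q :
  normc (pilot I c n * conjc (pilot I c (submod n q))) =
  (pilot_mask I n * pilot_mask I (submod n q))%:R.
Proof.
rewrite normcM normc_conjc natrM /pilot /pilot_mask.
by congr (_ * _); case: ifP => [/hc|] //; rewrite normc0.
Qed.

(** Parseval applied to the products of pilots: their moduli are 0 or 1, and exactly [h I q] of them
    are 1. *)
Lemma sum_g q : \sum_k g I c k q = N%:R * (h I q)%:R.
Proof.
under eq_bigr do rewrite g_ambiguity.
rewrite parseval; congr (_ * _); rewrite /h natr_sum; apply: eq_bigr => n _.
rewrite pilot_term /pilot_mask.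
by case: (n \in I); case: (_ \in I); rewrite expr2 !natrM ?mulr1 ?mulr0.
Qed.

Lemma g_ge0 k q : 0 <= g I c k q. Proof. exact: sqr_ge0. Qed.

Lemma g_le k q : g I c k q <= (h I q)%:R ^+ 2.
Proof.
rewrite g_ambiguity lerXn2r ?nnegrE ?ler0n ?normc_ge0 //.
rewrite (le_trans (normc_sum_le _ _)) // /h natr_sum ler_sum // => n _.
by rewrite normcM normc_omega mulr1 pilot_term.
Qed.

Lemma card_fibers (S : {set 'I_N * 'I_N}) :
  (#|S| = \sum_q #|[set k | (k, q) \in S]|)%N.
Proof.
rewrite -sum1_card big_mkcond /=.
rewrite (eq_bigr (fun p => if (p.1, p.2) \in S then 1 else 0)%N); last by case.
rewrite -(pair_bigA _ (fun k q => if (k, q) \in S then 1 else 0)%N) exchange_big /=.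
apply: eq_bigr => q _; rewrite -sum1_card [RHS]big_mkcond.
by apply: eq_bigr => k _; rewrite inE.
Qed.

Lemma card_Lset :
  #|Lset I c|%:R = \sum_(q in Dset I) #|[set k | g I c k q == 0]|%:R :> R.
Proof.
rewrite -natr_sum card_fibers [in RHS]big_mkcond; congr (_%:R).
apply: eq_bigr => q _; have [qD|/negbTE qD] := boolP (q \in Dset I).
  congr #|pred_of_set _|; apply/setP => k; have /DsetP [/eqP q0 _] := qD.
  by rewrite 3!finset.in_set /= q0 qD.
by rewrite eq_card0 // => k; rewrite 2!finset.in_set /= qD andbF.
Qed.

Lemma card_Uset :
  #|Uset I c|%:R = \sum_(q in Dset I) #|[set k | g I c k q == L%:R ^+ 2]|%:R :> R.
Proof.
rewrite -natr_sum card_fibers [in RHS]big_mkcond; congr (_%:R).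
apply: eq_bigr => q _; have [qD|/negbTE qD] := boolP (q \in Dset I).
  congr #|pred_of_set _|; apply/setP => k; have /DsetP [/eqP q0 _] := qD.
  by rewrite 3!finset.in_set /= q0 qD.
by rewrite eq_card0 // => k; rewrite 2!finset.in_set /= qD andbF.
Qed.

Hypothesis L0 : (0 < L)%N.
Let LR0 : 0 < L%:R :> R. Proof. by rewrite ltr0n. Qed.

Lemma h_Dset q : q \in Dset I -> h I q = L.
Proof. by rewrite inE => /andP[_ /eqP]. Qed.

(** The values of [g] sum to N L and are at most L^2, hence N L <= (N - z) L^2 for z zeros. *)
Lemma card_zeros_le q : q \in Dset I ->
  #|[set k | g I c k q == 0]|%:R <= N%:R / L%:R * (L%:R - 1) :> R.
Proof.
move=> /h_Dset hq; have := sum_le_card_neq0 (g_le^~ q).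
rewrite sum_g hq card_ord => H.
rewrite mulrAC ler_pdivlMr //.
rewrite -(ler_pM2r LR0).
have := H; set z := _%:R; nra.
Qed.

(** The peaks alone contribute L^2 each to a sum of nonnegative values equal to N L. *)
Lemma card_peaks_le q : q \in Dset I ->
  #|[set k | g I c k q == L%:R ^+ 2]|%:R <= N%:R / L%:R :> R.
Proof.
move=> /h_Dset hq; have := card_max_le_sum (L%:R ^+ 2) (fun k => g_ge0 k q).
rewrite sum_g hq => H; rewrite ler_pdivlMr // -(ler_pM2r LR0).
by move: H; rewrite expr2 mulrA.
Qed.

(** For a fixed pilot [i0], the map sending [q] to i0 - q is injective from [Dset I] into the pilots
    other than [i0]. *)
Lemma card_Dset_le : (#|Dset I| <= L.-1)%N.
Proof.
have [i0 i0I] : exists i0, i0 \in I by apply/card_gt0P.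
rewrite (cardsD1 i0 I) i0I /=.
rewrite -(card_in_imset (f := fun q => submod i0 q)).
  apply: subset_leq_card; apply/fintype.subsetP => _ /imsetP [q /DsetP [q0 hq] ->].
  by rewrite !inE hq // andbT; apply: contra_notN q0 => /eqP /submod_fixed.
by move=> q q' _ _; exact: submod_inj.
Qed.

Lemma Lset_bound : #|Lset I c|%:R <= N%:R / L%:R * (L%:R - 1) * #|Dset I|%:R :> R.
Proof.
by rewrite card_Lset; apply: sum_le_const => q; exact: card_zeros_le.
Qed.

Lemma Uset_bound : #|Uset I c|%:R <= N%:R / L%:R * #|Dset I|%:R :> R.
Proof.
by rewrite card_Uset; apply: sum_le_const => q; exact: card_peaks_le.
Qed.

Lemma Dset_bound : #|Dset I|%:R <= L%:R - 1 :> R.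
Proof.
by rewrite -[L in leRHS](prednK L0) -natr1 addrK ler_nat card_Dset_le.
Qed.

(** Equality of the totals forces equality at every [q]: exactly N / L values of [g] are nonzero,
    each at most L^2, with sum N L. So every nonzero value is L^2, and one exists because the sum is
    positive. *)
Lemma Lset_tight q : #|Lset I c|%:R = N%:R / L%:R * (L%:R - 1) * #|Dset I|%:R :> R ->
  q \in Dset I -> exists k, g I c k q = L%:R ^+ 2.
Proof.
rewrite card_Lset => /(sum_eq_const card_zeros_le) Z qD; have {}Z := Z q qD.
have hq := h_Dset qD.
have S : \sum_k g I c k q =
    (#|'I_N|%:R - #|[set k | g I c k q == 0]|%:R) * (h I q)%:R ^+ 2.
  by rewrite sum_g Z hq card_ord; field; rewrite gt_eqF.
have N0 : (N%:R : R) != 0 by rewrite pnatr_eq0 -lt0n (ord_pos q).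
have [k gk] : exists k, g I c k q != 0.
  apply/existsP; rewrite -negb_forall; apply/negP => /forallP g0.
  have : \sum_k g I c k q = 0 by apply: big1 => k _; apply/eqP; exact: g0.
  by move/eqP; rewrite sum_g hq mulf_eq0 (negbTE N0) gt_eqF.
by exists k; rewrite -hq; apply: (sum_eq_card_neq0 (g_le^~ q) S).
Qed.

(** Equality of the totals forces N / L peaks at every [q], a positive number. *)
Lemma Uset_tight q : #|Uset I c|%:R = N%:R / L%:R * #|Dset I|%:R :> R ->
  q \in Dset I -> exists k, g I c k q = L%:R ^+ 2.
Proof.
rewrite card_Uset => /(sum_eq_const card_peaks_le) Z qD; have {}Z := Z q qD.
have : (0 < #|[set k | g I c k q == L%:R ^+ 2]|)%N.
  by rewrite -(ltr_nat R) Z divr_gt0 // ltr0n (ord_pos q).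
by case/card_gt0P => k; rewrite inE => /eqP gk; exists k.
Qed.

End Bounds.

(** * Equally spaced patterns and chirps *)

Section ShiftInvariance.
Variables (N : nat) (I : {set 'I_N}).
Local Notation L := #|I|.
Implicit Types (i q : 'I_N) (s t : nat).

(** The shift is a natural number, so that invariant shifts can be added and multiplied without
    reduction and a least positive one can be chosen. *)
Definition shift_invariant t := [forall i in I, addmod i t \in I].

Lemma shift_invariantP t :
  reflect (forall i, i \in I -> addmod i t \in I) (shift_invariant t).
Proof. exact: forall_inP. Qed.

Lemma shift_invariantD s t :
  shift_invariant s -> shift_invariant t -> shift_invariant (s + t).
Proof.
move=> /shift_invariantP hs /shift_invariantP ht; apply/shift_invariantP => i iI.
by rewrite -addmodD; apply/ht/hs.
Qed.

Lemma shift_invariantM n t : shift_invariant t -> shift_invariant (n * t).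
Proof.
move=> ht; elim: n => [|n IH]; last by rewrite mulSn; exact: shift_invariantD.
by apply/shift_invariantP => i; rewrite addmod0.
Qed.

Lemma shift_invariantDN s t : shift_invariant (s + N * t) = shift_invariant s.
Proof. by apply: eq_forallb => i; rewrite addmodDN. Qed.

Lemma shift_invariantN : shift_invariant N.
Proof. by apply/shift_invariantP => i; rewrite addmodN. Qed.

Lemma Dset_shift q : (q \in Dset I) = ((q : nat) != 0%N) && shift_invariant q.
Proof.
have qN := ltn_ord q.
apply/DsetP/andP => -[q0 hq].
  split; first exact/eqP.
  have hNq : shift_invariant (N - q) by apply/shift_invariantP.
  (* q is congruent to - (N - q), that is to (N - 1) (N - q), modulo N. *)
  rewrite -(shift_invariantDN q (N - q).-1).
  rewrite (_ : q + _ = N.-1 * (N - q))%N; last by nia.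
  exact: shift_invariantM.
split; first exact/eqP.
suff /shift_invariantP : shift_invariant (N - q) by [].
rewrite -(shift_invariantDN (N - q) q.-1).
rewrite (_ : _ + _ = N.-1 * q)%N; last by move/eqP: q0; nia.
exact: shift_invariantM.
Qed.

(** When [Dset I] has L - 1 elements, the injection of [card_Dset_le] is onto: the invariant shifts
    act transitively on [I]. *)
Lemma Dset_full_reach i0 i : #|Dset I| = L.-1 -> i0 \in I -> i \in I ->
  exists2 t, (t < N)%N & shift_invariant t /\ i = addmod i0 t.
Proof.
move=> cD i0I iI; have [->|ii0] := eqVneq i i0.
  exists 0%N; rewrite ?addmod0 ?(ord_pos i) //; split => //.
  by apply/shift_invariantP => j; rewrite addmod0.
have inj : {in Dset I &, injective (fun q => submod i0 q)}.
  by move=> q q' _ _; exact: submod_inj.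
have : [set submod i0 q | q in Dset I] = I :\ i0.
  apply/eqP; rewrite eqEcard (card_in_imset inj) cD (cardsD1 i0 I) i0I leqnn andbT.
  apply/fintype.subsetP => _ /imsetP [q /DsetP [q0 hq] ->].
  by rewrite !inE hq // andbT; apply: contra_notN q0 => /eqP /submod_fixed.
move/setP/(_ i); rewrite !inE ii0 iI => /imsetP [q].
move=> /DsetP [q0 hq] ->; exists (N - q)%N; last by split => //; exact/shift_invariantP.
by have := ltn_ord q; lia.
Qed.

(** The least positive invariant shift [T] divides all invariant shifts, among them [N]. By
    transitivity [I] is the orbit of [i0] under multiples of [T], whence L = N / T. *)
Lemma Dset_full_equally_spaced : (0 < L)%N -> #|Dset I| = L.-1 ->
  (L %| N)%N /\ equally_spaced I (N %/ L).
Proof.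
move=> /card_gt0P [i0 i0I] cD; have N0 := ord_pos i0.
have exT : exists t, (0 < t)%N && shift_invariant t.
  by exists N; rewrite N0 shift_invariantN.
case: (ex_minnP exT) => T /andP[T0 sT] Tmin.
have dvdT a : shift_invariant a -> (T %| a)%N.
  move=> sa; apply: contraTT isT => Ta.
  suff : (T <= a %% T)%N by rewrite leqNgt ltn_pmod.
  apply: Tmin; rewrite lt0n Ta /=.
  (* Euclidean division without subtraction: modulo [N], removing a multiple of [T] amounts to
     adding it N - 1 times. *)
  rewrite -(shift_invariantDN _ (a %/ T * T)).
  rewrite (_ : _ + _ = a + (N.-1 * (a %/ T)) * T)%N; last first.
    rewrite -mulnA [X in _ = (X + _)%N](divn_eq a T).
    by move: (a %/ T * T)%N (a %% T)%N => x r; nia.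
  by apply: shift_invariantD => //; exact: shift_invariantM.
have TN : (T %| N)%N by apply: dvdT; exact: shift_invariantN.
have reach i j : i \in I -> j \in I ->
    exists2 l : 'I_(N %/ T), j = addmod i (l * T) & (l * T < N)%N.
  move=> iI jI; have [t tN [st ->]] := Dset_full_reach cD iI jI.
  have tT : (t %/ T < N %/ T)%N by rewrite ltn_divRL // divnK // dvdT.
  by exists (Ordinal tT); rewrite /= divnK // dvdT.
have LE : L = (N %/ T)%N.
  rewrite -[RHS]card_ord -(card_imset _ (f := fun l : 'I_(N %/ T) => addmod i0 (l * T))).
    congr #|pred_of_set _|; apply/setP => j; apply/idP/imsetP => [jI|[l _ ->]].
      by have [l -> _] := reach i0 j i0I jI; exists l.
    by have /shift_invariantP := shift_invariantM l sT; apply.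
  move=> l l' /eqP; rewrite addmod_eq !modn_small.
  - by rewrite eqn_pmul2r // => /eqP /val_inj.
  - by rewrite -ltn_divRL.
  - by rewrite -ltn_divRL.
have NLT : (N = L * T)%N by rewrite LE divnK.
have L0 : (0 < L)%N by apply/card_gt0P; exists i0.
split; first by rewrite [X in (_ %| X)%N]NLT dvdn_mulr.
rewrite [X in (X %/ _)%N]NLT mulKn //; split => // i iI; split.
  by have /shift_invariantP := sT; apply.
(* A pilot inside the gap would lie at a distance that is a multiple of [T], yet strictly between 0
   and [T]. *)
move=> t /andP[t0 tT]; apply/negP => itI.
have [l /eqP + lN] := reach _ _ iI itI; rewrite addmod_eq.
rewrite !modn_small //; last by apply: leq_trans tT _; exact: dvdn_leq.
move=> /eqP tl; have : (T %| t)%N by rewrite tl dvdn_mull.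
by rewrite gtnNdvd.
Qed.

Lemma equally_spaced_shift T : equally_spaced I T -> shift_invariant T.
Proof. by move=> [_ h]; apply/shift_invariantP => i /h []. Qed.

Section Parametrization.
Hypotheses (L0 : (0 < L)%N) (LN : (L %| N)%N) (eqI : equally_spaced I (N %/ L)).
Local Notation T := (N %/ L)%N.
Variable i0 : 'I_N.
Hypothesis i0I : i0 \in I.

Lemma period_mul : (L * T)%N = N. Proof. by rewrite mulnC divnK. Qed.

Lemma orbit_mem l : addmod i0 (l * T) \in I.
Proof.
by have /shift_invariantP := shift_invariantM l (equally_spaced_shift eqI); apply.
Qed.

Lemma orbit_lt l : (l < L)%N -> (l * T < N)%N.
Proof.
move=> lL; apply: (@leq_trans (L * T)); last by rewrite period_mul.
by rewrite ltn_pmul2r //; case: eqI.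
Qed.

Lemma orbit_inj : injective (fun l : 'I_L => addmod i0 (l * T)).
Proof.
move=> l l' /eqP; rewrite addmod_eq !modn_small ?orbit_lt //.
by rewrite eqn_pmul2r; [move=> /eqP /val_inj|case: eqI].
Qed.

Lemma orbit_image : [set addmod i0 (l * T) | l : 'I_L] = I.
Proof.
apply/eqP; rewrite eqEcard card_imset ?card_ord ?leqnn ?andbT; last exact: orbit_inj.
by apply/fintype.subsetP => _ /imsetP [l _ ->]; exact: orbit_mem.
Qed.

Lemma sum_orbit (V : nmodType) (F : 'I_N -> V) :
  \sum_(i in I) F i = \sum_(l < L) F (addmod i0 (l * T)).
Proof.
rewrite -{1}orbit_image big_imset //=.
by move=> l l' _ _; exact: orbit_inj.
Qed.

Lemma orbit_periodic l : addmod i0 ((l + L) * T) = addmod i0 (l * T).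
Proof. by rewrite mulnDl period_mul; have := addmodDN i0 (l * T) 1; rewrite muln1. Qed.

End Parametrization.

(** Starting from the pilot i - q, steps of [T] lead to a pilot lying q mod T before [i]; a nonzero
    remainder would put [i] inside a gap. *)
Lemma equally_spaced_dvd T i q : equally_spaced I T -> i \in I ->
  submod i q \in I -> (T %| N)%N -> (T %| q)%N.
Proof.
move=> eqI iI jI TN; have [T0 hI] := eqI.
have [/eqP //|r0] := posnP (q %% T)%N.
exfalso.
have qq : (0 < q %% T < T)%N by rewrite r0 ltn_pmod.
have := shift_invariantM (q %/ T) (equally_spaced_shift eqI).
move=> /shift_invariantP /(_ _ jI) kI.
have [_ /(_ _ qq) /negP] := hI _ kI; apply.
by rewrite addmodD -divn_eq submodK.
Qed.

End ShiftInvariance.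

(** * Periodicity, correlation and characterisation of chirps *)

Section ChirpPhase.
Variables (R : realType) (L : nat).
Hypothesis L0 : (0 < L)%N.
Let LR : (L%:R : R) != 0. Proof. by rewrite pnatr_eq0 -lt0n. Qed.

(** Treats both parities of [L] in one formula: l (l + 1) is l^2 plus a linear term that is present
    for odd [L] only. *)
Definition chirp_phase (u nu : int) (l : nat) : R :=
  - (pi * u%:~R / L%:R * (l%:R ^+ 2 + (odd L)%:R * l%:R)) + 2 * pi * nu%:~R / L%:R * l%:R.

Lemma chirpE (A : R[i]) u nu l : chirp L A u nu l = A * cis (chirp_phase u nu l).
Proof.
rewrite /chirp /chirp_phase cisD mulrA; congr (_ * cis (- (_ * _)) * _).
case: odd; last by rewrite mul0r addr0 natrX.
by rewrite natrM natrD mul1r; ring.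
Qed.

(** Evenness of L + (L mod 2) is what makes the chirp periodic for either parity of [L]. *)
Lemma odd_uphalf : L%:R + (odd L)%:R = 2 * (uphalf L)%:R :> R.
Proof.
rewrite -natrD -natrM; congr (_%:R).
by rewrite -[in LHS](odd_double_half L) uphalf_half; lia.
Qed.

Lemma chirp_periodic (A : R[i]) u nu l : chirp L A u nu (l + L) = chirp L A u nu l.
Proof.
rewrite !chirpE; congr (_ * _).
(* The phase changes by 2 pi nu - pi u (2 l + L + odd L), a whole number of turns since L + odd L is
   twice [uphalf L]. *)
have -> : chirp_phase u nu (l + L) =
    chirp_phase u nu l + 2 * pi * (nu - u * (l + uphalf L)%:Z)%:~R.
  rewrite /chirp_phase rmorphB rmorphM /= natrD -[(l + uphalf L)%:~R]/((l + uphalf L)%:R).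
  have := odd_uphalf; rewrite natrD; move: (odd L)%:R (uphalf L)%:R => o h oh.
  have -> : o = 2 * h - L%:R by rewrite -oh; ring.
  by field.
by rewrite cisD cis_2piz mulr1.
Qed.

(** The terms quadratic in [j] cancel, so the correlation at lag [m] is a pure tone in [j] of
    frequency -u m. *)
Lemma chirp_mul_conj (A : R[i]) u nu m j : normc A = 1 ->
  chirp L A u nu (j + m) * conjc (chirp L A u nu j) =
  cis (chirp_phase u nu m) * cis (- (2 * pi * u%:~R * m%:R * j%:R / L%:R)).
Proof.
move=> A1; rewrite !chirpE conjcM mulrACA mulr_conjc A1 expr1n mul1r -cisN -!cisD.
by congr cis; rewrite /chirp_phase natrD; field.
Qed.

Lemma normc_chirp (A : R[i]) u nu l : normc A = 1 -> normc (chirp L A u nu l) = 1.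
Proof. by move=> A1; rewrite chirpE normcM normc_cis A1 mulr1. Qed.

Lemma chirp_zadoff_chu u l : chirp L (1 : R[i]) u 0 l = zadoff_chu R L u l.
Proof.
rewrite chirpE mul1r /zadoff_chu; congr cis.
rewrite /chirp_phase modn2 natrD; field.
exact: LR.
Qed.

(** Unrolling the recurrence gives a quadratic phase times the powers of [tau]. Cyclic closure makes
    [tau], up to a fixed phase, an L-th root of unity, which supplies the linear term. *)
Lemma chirp_recurrence (f : nat -> R[i]) (tau : R[i]) (k : nat) :
  normc tau = 1 ->
  (forall l, f l.+1 = tau * f l * cis (- (2 * pi * k%:R * l.+1%:R / L%:R))) ->
  f L = f 0%N -> f 0%N != 0 ->
  exists nu : int, forall l, f l = chirp L (f 0%N) k nu l.
Proof.
move=> tau1 rec per f0.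
have fE l : f l = f 0%N * tau ^+ l * cis (- (pi * k%:R / L%:R * (l%:R * (l%:R + 1)))).
  elim: l => [|l IH]; first by rewrite mul0r mulr0 oppr0 cis0 expr0 !mulr1.
  rewrite rec IH exprS; set a := cis _; set b := cis _; set c := cis _.
  have -> : c = a * b by rewrite /a /b /c -cisD; congr cis; rewrite -natr1; field.
  by ring.
(* The factor makes the cyclic condition f L = f 0 read sigma ^ L = 1. *)
pose sigma := tau * cis (- (pi * k%:R * (L%:R + 1) / L%:R)).
have sL : sigma ^+ L = 1.
  apply: (mulfI f0); rewrite mulr1 -[RHS]per (fE L) exprMn cisX !mulrA; congr (_ * cis _).
  by field.
have [nu snu] := prim_rootP (omega_prim R L0) sL.
have tauE : tau = cis (2 * pi * nu%:R / L%:R + pi * k%:R * (L%:R + 1) / L%:R).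
  rewrite cisD -omegaX -snu /sigma -mulrA -cisD addNr cis0 mulr1 //.
(* The shift of [nu] by [k * uphalf L] accounts for the phase removed from [tau] and for replacing
   l^2 + l by l^2 + (odd L) l. *)
exists (nu%:Z + k%:Z * uphalf L) => l.
rewrite fE chirpE -mulrA tauE cisX -cisD; congr (_ * cis _).
rewrite /chirp_phase rmorphD rmorphM /=; have := odd_uphalf.
rewrite -[(uphalf L)%:~R]/((uphalf L)%:R) -[k%:~R]/(k%:R) -[nu%:~R]/((nat_of_ord nu)%:R).
move: (odd L)%:R (uphalf L)%:R => o h oh.
have -> : o = 2 * h - L%:R by rewrite -oh; ring.
by field.
Qed.

End ChirpPhase.

(** * Chirps on equally spaced patterns *)

Section ChirpPilots.
Variables (R : realType) (N : nat) (I : {set 'I_N}) (c : 'I_N -> R[i]).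
Local Notation L := #|I|.
Local Notation T := (N %/ L)%N.
Local Notation w := (omega R N).
Hypotheses (L0 : (0 < L)%N) (LN : (L %| N)%N) (eqI : equally_spaced I T).
Variable i0 : 'I_N.
Hypothesis i0I : i0 \in I.

Let N0 : (0 < N)%N := ord_pos i0.
Let LR : (L%:R : R) != 0. Proof. by rewrite pnatr_eq0 -lt0n. Qed.
Let TR : (T%:R : R) != 0.
Proof. by rewrite pnatr_eq0 -lt0n; case: eqI. Qed.
Let NR : (N%:R : R) = L%:R * T%:R. Proof. by rewrite -natrM period_mul. Qed.

Lemma omega_period l : w ^+ (l * T) = cis (2 * pi * l%:R / L%:R).
Proof. by rewrite omegaX natrM NR; congr cis; field; rewrite LR TR. Qed.

Lemma omega_periodM l k :
  (w ^+ (l * T)) ^+ k = cis (2 * pi * l%:R / L%:R * k%:R).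
Proof. by rewrite omega_period cisX. Qed.

Lemma ambiguity_pilot k q : ambiguity (pilot I c) k q =
  \sum_(n in I) pilot I c n * conjc (pilot I c (submod n q)) * w ^+ (n * k).
Proof.
rewrite /ambiguity [RHS]big_mkcond; apply: eq_bigr => n _.
by rewrite /pilot; case: (n \in I) => //; rewrite !mul0r.
Qed.

Lemma submod_period (q : 'I_N) n m : (q : nat) = (m * T)%N ->
  submod (addmod i0 ((n + m) * T)) q = addmod i0 (n * T).
Proof. by move=> qm; rewrite mulnDl -addmodD -qm addmodK. Qed.

(** Only the peak at Doppler shift N / L is used: equality in the triangle inequality makes the L
    unimodular terms equal, and read along the orbit of [i0] this is the recurrence above with u =
    k. *)
Lemma peak_chirp : (forall i : 'I_N, i \in I -> normc (c i) = 1) ->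
  (forall q, q \in Dset I -> exists k, g I c k q = L%:R ^+ 2) ->
  exists (A : R[i]) (u nu : int), normc A = 1 /\ chirp_pilots L I c i0 A u nu.
Proof.
move=> hc peak; exists (c i0).
pose f l := pilot I c (addmod i0 (l * T)).
have fI l : f l = c (addmod i0 (l * T)) by rewrite /f /pilot orbit_mem.
have f1 l : normc (f l) = 1 by rewrite fI hc // orbit_mem.
have f00 : f 0%N = c i0 by rewrite fI addmod0.
(* With a single pilot N / L = N is not an index; the one value [c i0] is a chirp with u = nu =
   0. *)
have [L1|L1] := leqP L 1.
  exists 0, 0; split; first exact: hc.
  move=> l lL.
  have -> : l = 0%N by lia.
  rewrite -[LHS]/(f 0%N) f00 chirpE /chirp_phase.
  by rewrite expr0n /= !(mulr0, mul0r, addr0, oppr0) cis0 mulr1.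
have TN : (T < N)%N by rewrite ltn_Pdiv.
pose q : 'I_N := Ordinal TN.
have qD : q \in Dset I.
  by rewrite Dset_shift (equally_spaced_shift eqI) andbT /= -lt0n; case: eqI.
have [k gk] := peak q qD.
have q1 : (q : nat) = (1 * T)%N by rewrite mul1n.
pose F n := pilot I c n * conjc (pilot I c (submod n q)) * w ^+ (n * k).
have F1 n : n \in I -> `|F n| = 1.
  move=> nI; rewrite norm_normc /F !normcM normc_conjc normc_omega mulr1 /pilot nI.
  by have /DsetP [_ ->] := qD => //; rewrite !hc ?mulr1 //; have /DsetP [_ ->] := qD.
have sumF : `|\sum_(n in I) F n| = \sum_(n in I) `|F n|.
  rewrite [RHS](eq_bigr (fun=> 1)) // sumr_const norm_normc -ambiguity_pilot.
  transitivity ((L%:R : R)%:C); last exact: (rmorph_nat (real_complex R)).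
  congr (_%:C); apply/eqP.
  rewrite -(eqrXn2 (n := 2)) ?normc_ge0 ?ler0n //.
  by rewrite -g_ambiguity gk.
have [t /eqP t1 Ft] := normC_sum_eq1 sumF F1.
(* [t] is the common value of the terms; the conjugate removes the phase due to the base index
   [i0]. *)
pose tau := t * conjc (w ^+ (i0 * k)).
have [||||nu fnu] := @chirp_recurrence R L L0 f tau k.
- rewrite /tau normcM normc_conjc normc_omega mulr1.
  by move: t1; rewrite norm_normc => -[].
- move=> l; have := Ft _ (orbit_mem eqI i0I l.+1).
  rewrite /F -addn1 (submod_period _ q1) -/(f l) -/(f (l + 1)%N) addn1.
  rewrite exprM omega_addmod exprMn omega_periodM -exprM => ft.
  (* The equation of terms is solved for [f l.+1] by inverting unimodular factors through their
     conjugates. *)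
  have fl : f l * conjc (f l) = 1 by rewrite mulr_conjc f1 expr1n.
  rewrite /tau -ft cisN.
  rewrite (_ : 2 * pi * k%:R * l.+1%:R / L%:R =
    2 * pi * l.+1%:R / L%:R * k%:R); last by field.
  set a := w ^+ _; set b := cis _.
  have ab : a * conjc a = 1 by rewrite mulr_conjc normc_omega expr1n.
  have bb : b * conjc b = 1 by rewrite mulr_conjc normc_cis expr1n.
  transitivity (f l.+1 * (f l * conjc (f l)) * (a * conjc a) * (b * conjc b)).
    by rewrite fl ab bb !mulr1.
  by ring.
- by rewrite /f -[X in addmod _ (X * _)]add0n orbit_periodic.
- by apply/eqP => h; have := f1 0%N; rewrite h normc0 => /eqP; rewrite eq_sym oner_eq0.
- exists k, nu; split; first exact: hc.
  by move=> l lL; rewrite -f00 -fnu.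
Qed.

Section Evaluation.
Variables (A : R[i]) (u nu : int).
Hypotheses (A1 : normc A = 1) (ch : chirp_pilots L I c i0 A u nu).

(** Both sides have period [L] in [l], which extends the chirp form beyond l < L. *)
Lemma pilot_chirp l : pilot I c (addmod i0 (l * T)) = chirp L A u nu l.
Proof.
rewrite {1}(divn_eq l L) [in RHS](divn_eq l L).
elim: (l %/ L)%N => [|n IH]; first by rewrite mul0n add0n ch // ltn_pmod.
by rewrite mulSn -addnA addnC orbit_periodic // chirp_periodic // IH.
Qed.

Lemma chirp_pilots_norm i : i \in I -> normc (c i) = 1.
Proof.
move=> iI; have := iI; rewrite -{1}(orbit_image LN eqI i0I) => /imsetP [l _ il].
by have := pilot_chirp l; rewrite -il /pilot iI => ->; exact: normc_chirp.
Qed.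

Lemma h_period (q : 'I_N) m : (q : nat) = (m * T)%N -> h I q = L.
Proof.
move=> qm; have [q0|q0] := eqVneq (q : nat) 0%N.
  rewrite h_card; congr #|pred_of_set _|; apply/setP => n; rewrite inE.
  by rewrite /submod q0 subn0 addmodN andbb.
apply: h_Dset; rewrite Dset_shift q0 qm.
exact: shift_invariantM (equally_spaced_shift eqI).
Qed.

(** The pilot correlation is a pure tone, so the sum is a unimodular constant [C] times a geometric
    series of ratio [z], an L-th root of unity equal to 1 exactly when [L] divides k - u m. *)
Lemma g_chirp_period (k q : 'I_N) m : (q : nat) = (m * T)%N -> (m < L)%N ->
  g I c k q = if (L%:Z %| k%:Z - u * m%:Z)%Z then L%:R ^+ 2 else 0.
Proof.
move=> qm mL; rewrite g_ambiguity ambiguity_pilot (sum_orbit LN eqI i0I).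
pose z : R[i] := cis (2 * pi * (k%:Z - u * m%:Z)%:~R / L%:R).
pose C := cis (chirp_phase R L u nu m) * w ^+ (i0 * k) *
  cis (- (2 * pi * u%:~R * m%:R * (L - m)%:R / L%:R)).
have zL : z ^+ L = 1.
  by rewrite cisX mulfVK // cis_2piz.
have C1 : normc C = 1 by rewrite !normcM !normc_cis normc_omega !mulr1.
rewrite (eq_bigr (fun l : 'I_L => C * z ^+ l)); last first.
  move=> l _.
  (* The index l - m is written l + (L - m) to stay in the natural numbers; this is the source of L
     - m in [C]. *)
  have li : addmod i0 ((l + (L - m) + m) * T) = addmod i0 (l * T).
    by rewrite -addnA subnK ?orbit_periodic // ltnW.
  rewrite -{1 2}li (submod_period _ qm) !pilot_chirp chirp_mul_conj //.
  rewrite exprM omega_addmod exprMn omega_periodM -exprM.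
  have -> : z ^+ l = cis (2 * pi * (k%:Z - u * m%:Z)%:~R / L%:R * l%:R) by exact: cisX.
  rewrite /C; set a := cis (chirp_phase _ _ _ _ _); set b := w ^+ _.
  transitivity (a * b * (cis (- (2 * pi * u%:~R * m%:R * (l + (L - m))%:R / L%:R)) *
     cis (2 * pi * l%:R / L%:R * k%:R))); first by ring.
  rewrite -cisD -[RHS]mulrA -cisD; congr (_ * cis _).
  rewrite rmorphB rmorphM /= -[k%:~R]/((nat_of_ord k)%:R) -[m%:~R]/(m%:R) natrD.
  by field.
rewrite -mulr_sumr normcM C1 mul1r sum_expr_unity // cis_int_eq1 //.
case: ifP => _; last by rewrite normc0 expr0n.
by rewrite -(rmorph_nat (@real_complex R)) /= expr0n addr0 sqrtr_sqr normr_nat.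
Qed.

(** Two pilots never differ by [q], so every product of pilots, and of mask values, is 0. *)
Lemma g_chirp_other (k q : 'I_N) : ~~ (T %| q)%N -> g I c k q = 0 /\ h I q = 0%N.
Proof.
move=> Tq; have out n : n \in I -> submod n q \notin I.
  move=> nI; apply: contra Tq => mI; apply: (equally_spaced_dvd eqI nI mI).
  by rewrite -[X in (_ %| X)%N](period_mul LN) dvdn_mull.
split.
  rewrite g_ambiguity ambiguity_pilot big1 ?normc0 ?expr0n // => n nI.
  by rewrite {2}/pilot (negbTE (out n nI)) conjc0 mulr0 mul0r.
rewrite h_card; apply: eq_card0 => n; rewrite !inE.
by apply/negP => /andP[nI]; apply/negP/out.
Qed.

End Evaluation.
End ChirpPilots.

(** * The expected squared ambiguity function *)

Section ExpectedAmbiguity.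
Context d (T : measurableType d) (R : realType) (P : probability T R).
Context dd (TT : measurableType dd) (PP : probability TT R).
Variables (N : nat) (I : {set 'I_N}) (c : 'I_N -> R[i]).
Variables (D : TT -> R[i]) (data : 'I_N -> T -> R[i]).
Hypothesis hc : forall i : 'I_N, i \in I -> normc (c i) = 1.
Hypothesis hD : data_symbol PP D.
Hypothesis hdata : iid_copies P (~: I) data PP D.
Local Notation w := (omega R N).

Definition symbol (t : T) (i : 'I_N) : R[i] := if i \in I then c i else data i t.

Definition symbol_moment (i : 'I_N) (a b : nat) : R[i] :=
  if i \in I then c i ^+ a * conjc (c i) ^+ b else moment PP D a b.

Lemma expectation_monomials (a b : 'I_N -> nat) : (forall i, (a i + b i <= 4)%N) ->
  let f t := \prod_i (symbol t i ^+ a i * conjc (symbol t i) ^+ b i) in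
  complex_integrable P f /\
  complex_expectation P f = \prod_i symbol_moment i (a i) (b i).
Proof.
move=> ab f; have [mX law indep] := hdata.
pose Y i := @pair_of_complex R \o data i.
pose C := \prod_(i in I) (c i ^+ a i * conjc (c i) ^+ b i).
have fE t : f t = C * \prod_(i in ~: I) monomial (a i) (b i) (Y i t).
  rewrite /f (bigID (mem I)) /=; congr (_ * _).
    by apply: eq_bigr => i iI; rewrite /symbol iI.
  apply: eq_big => [i|i iI]; first by rewrite inE.
  by rewrite /symbol (negbTE iI) monomial_pair.
have mom i : i \in ~: I ->
    complex_integrable P (fun t => monomial (a i) (b i) (Y i t)) /\
    complex_expectation P (fun t => monomial (a i) (b i) (Y i t)) = moment PP D (a i) (b i).
  move=> iI; have [mr mi] := complex_measurable_monomial R (a i) (b i).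
  rewrite momentE.
  apply: (same_law_complex_expectation (mX i iI) (data_symbol_rv hD) (law i iI)) => //.
  exact: complex_integrable_monomial.
have [|iprod eprod] := complex_expectation_prod_indep mX indep
    (F := fun i => monomial (a i) (b i)).
  move=> i iI; have [mr mi] := complex_measurable_monomial R (a i) (b i).
  by split => //; case: (mom i iI).
split.
  by apply: eq_complex_integrable (complex_integrableZ C iprod) => t; rewrite fE.
rewrite (eq_complex_expectation _ fE) complex_expectationZ // eprod.
rewrite [RHS](bigID (mem I)) /=; congr (_ * _).
  by apply: eq_bigr => i iI; rewrite /symbol_moment iI.
apply: eq_big => [i|i iI]; first by rewrite inE.
by case: (mom i iI) => _ ->; move: iI; rewrite inE => /negbTE iI; rewrite /symbol_moment iI.
Qed.

Section FixedDoppler.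
Variable q : 'I_N.
Implicit Types n m : 'I_N.

Definition quad (x : 'I_N -> R[i]) n m : R[i] :=
  x n * conjc (x (submod n q)) * conjc (x m * conjc (x (submod m q))).

(* Exponents of s_i and of its conjugate in quad s n m. *)
Definition expo1 n m (i : 'I_N) : nat := ((i == n) + (i == submod m q))%N.
Definition expo2 n m (i : 'I_N) : nat := ((i == submod n q) + (i == m))%N.

Lemma quad_prod x n m :
  quad x n m = \prod_i (x i ^+ expo1 n m i * conjc (x i) ^+ expo2 n m i).
Proof.
have single (y : 'I_N -> R[i]) j : \prod_i y i ^+ (i == j) = y j.
  rewrite (bigD1 j) //= eqxx expr1 big1 ?mulr1 // => i ij.
  by rewrite (negbTE ij).
under eq_bigr do rewrite !exprD.
rewrite !big_split /= !single /quad conjcM conjcK; ring.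
Qed.

Definition quad_mean n m : R[i] := \prod_i symbol_moment i (expo1 n m i) (expo2 n m i).

Lemma quad_expectation n m :
  complex_integrable P (fun t => quad (symbol t) n m) /\
  complex_expectation P (fun t => quad (symbol t) n m) = quad_mean n m.
Proof.
have [|i1 e1] := expectation_monomials (a := expo1 n m) (b := expo2 n m).
  by move=> i; rewrite /expo1 /expo2; do 4 case: (i == _).
have qE t : quad (symbol t) n m =
    \prod_i (symbol t i ^+ expo1 n m i * conjc (symbol t i) ^+ expo2 n m i).
  exact: quad_prod.
split; first by apply: eq_complex_integrable i1 => t; rewrite qE.
by rewrite /quad_mean -e1; apply: eq_complex_expectation => t; rewrite qE.
Qed.

Lemma symbol_moment00 i : symbol_moment i 0 0 = 1.
Proof. by rewrite /symbol_moment; case: ifP => _; rewrite ?expr0 ?mulr1 ?moment00. Qed.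

Lemma symbol_moment11 i : symbol_moment i 1 1 = 1.
Proof.
rewrite /symbol_moment; case: ifP => [/hc ci|_]; last by rewrite moment11.
by rewrite !expr1 mulr_conjc ci expr1n.
Qed.

Lemma symbol_moment_pilot i : i \in I -> symbol_moment i 2 2 = 1.
Proof. by move=> iI; rewrite /symbol_moment iI -exprMn mulr_conjc hc // !expr1n. Qed.

Lemma expected_sqr_ambiguity k :
  expected_sqr_dpaf P I c data k q =
  (complex.Re (\sum_(n < N) \sum_(m < N)
     quad_mean n m * (w ^+ (n * k) * conjc (w ^+ (m * k)))))%:E.
Proof.
pose Z t := \sum_(n < N) \sum_(m < N)
  quad (symbol t) n m * (w ^+ (n * k) * conjc (w ^+ (m * k))).
have ZE t : ((normc (dpaf (ofdm (symbols I c data t)) k q) ^+ 2)%:C) = Z t.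
  rewrite dpaf_ofdm -mulr_conjc (_ : ambiguity _ k q = ambiguity (symbol t) k q); last first.
    by apply: eq_bigr => n _; rewrite !mxE.
  rewrite /ambiguity conjc_sum mulr_suml; apply: eq_bigr => n _.
  rewrite mulr_sumr; apply: eq_bigr => m _.
  by rewrite /quad !conjcM; ring.
have ti n m : complex_integrable P
    (fun t => quad (symbol t) n m * (w ^+ (n * k) * conjc (w ^+ (m * k)))).
  have [i1 _] := quad_expectation n m.
  apply: eq_complex_integrable
    (complex_integrableZ (w ^+ (n * k) * conjc (w ^+ (m * k))) i1) => t.
  by rewrite mulrC.
have te n m : complex_expectation P
      (fun t => quad (symbol t) n m * (w ^+ (n * k) * conjc (w ^+ (m * k))))
    = quad_mean n m * (w ^+ (n * k) * conjc (w ^+ (m * k))).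
  have [i1 e1] := quad_expectation n m.
  rewrite -e1 [RHS]mulrC -complex_expectationZ //; apply: eq_complex_expectation => t.
  by rewrite mulrC.
have iZ : complex_integrable P Z by do 2 (apply: complex_integrable_sum => ?).
have eZ : complex_expectation P Z = \sum_(n < N) \sum_(m < N)
     quad_mean n m * (w ^+ (n * k) * conjc (w ^+ (m * k))).
  rewrite complex_expectation_sum => [|n]; last exact: complex_integrable_sum.
  by apply: eq_bigr => n _; rewrite complex_expectation_sum //; apply: eq_bigr => m _.
rewrite -eZ complex_expectationE /= /expected_sqr_dpaf unlock.
(* Integrability of the double sum makes the extended-real expectation finite. *)
rewrite /Rintegral fineK; last first.
  by apply: integrable_fin_num => //; case: iZ.
by apply: eq_integral => t _; rewrite -ZE.
Qed.

(** For n = m the four factors pair into two squared moduli at distinct indices, of mean 1. For n <>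
    m, a data index in any of the four positions carries exponents (1,0), (2,0), (0,1) or (0,2),
    whose moments vanish; only products of four pilots remain. *)
Lemma quad_mean_doppler n m : (q : nat) <> 0%N ->
  quad_mean n m = quad (pilot I c) n m +
    (1 - (pilot_mask I n * pilot_mask I (submod n q))%:R) * (n == m)%:R.
Proof.
move=> q0; have sn i : (submod i q == i) = false.
  by apply/eqP => /submod_fixed.
have sn' i : (i == submod i q) = false by rewrite eq_sym.
have [<-|nm] := eqVneq n m.
  have -> : quad_mean n n = 1.
    rewrite /quad_mean big1 // => i _; rewrite /expo1 /expo2.
    have [->|_] := eqVneq i n; first by rewrite sn' symbol_moment11.
    have [->|_] := eqVneq i (submod n q); first by rewrite symbol_moment11.
    exact: symbol_moment00.
  rewrite mulr1 /quad mulr_conjc (pilot_term hc) /pilot_mask.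
  by case: (n \in I); case: (_ \in I); rewrite /= ?expr1n ?expr0n ?subrr ?subr0 ?addr0 ?add0r.
have snm : (submod n q == submod m q) = false.
  by apply/negbTE; apply: contra nm => /eqP /(can_inj (submodK q)) ->.
rewrite mulr0 addr0.
have zero i : symbol_moment i (expo1 n m i) (expo2 n m i) = 0 -> quad_mean n m = 0.
  by move=> h; rewrite /quad_mean (bigD1 i) //= h mul0r.
have [nI|nI] := boolP (n \in I); last first.
  rewrite (zero n) /quad /pilot ?(negbTE nI) ?mul0r //.
  rewrite /symbol_moment (negbTE nI).
  rewrite /expo1 /expo2 eqxx sn' (negbTE nm).
  by case: (n == _); rewrite /= ?moment20 ?moment10.
have [n'I|n'I] := boolP (submod n q \in I); last first.
  rewrite (zero (submod n q)) /quad /pilot ?(negbTE n'I) ?conjc0 ?mulr0 ?mul0r //.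
  rewrite /symbol_moment (negbTE n'I).
  rewrite /expo1 /expo2 eqxx sn snm.
  by case: (_ == m); rewrite /= ?moment02 ?moment01.
have [mI|mI] := boolP (m \in I); last first.
  rewrite (zero m) /quad /pilot ?(negbTE mI) ?mul0r ?conjc0 ?mulr0 //.
  rewrite /symbol_moment (negbTE mI).
  rewrite /expo1 /expo2 eqxx sn' (eq_sym m n) (negbTE nm).
  by case: (m == _); rewrite /= ?moment02 ?moment01.
have [m'I|m'I] := boolP (submod m q \in I); last first.
  rewrite (zero (submod m q)) /quad /pilot ?(negbTE m'I) ?conjc0 ?mulr0 ?conjc0 ?mulr0 //.
  rewrite /symbol_moment (negbTE m'I).
  rewrite /expo1 /expo2 eqxx sn [submod m q == submod n q]eq_sym snm.
  by case: (_ == n); rewrite /= ?moment20 ?moment10.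
rewrite /quad /pilot nI n'I mI m'I -/(quad c n m) quad_prod.
apply: eq_bigr => i _; rewrite /symbol_moment; case: ifP => // /negbT iI.
have out j : j \in I -> (i == j) = false.
  by move=> jI; apply: contraNF iI => /eqP ->.
by rewrite /expo1 /expo2 !out // moment00 !expr0 mulr1.
Qed.

(** Without Doppler shift the product is |s_n|^2 |s_m|^2, of mean 1 unless both factors are the same
    data symbol, which gives the kurtosis. *)
Lemma quad_mean_zero n m : (q : nat) = 0%N ->
  quad_mean n m = 1 + ((kurtosis PP D)%:C - 1) * ((n == m) && (n \notin I))%:R.
Proof.
move=> q0; have sq i : submod i q = i by rewrite /submod q0 subn0 addmodN.
rewrite /quad_mean /expo1 /expo2 !sq; have [<-|nm] := eqVneq n m.
  rewrite (bigD1 n) //= eqxx big1 ?mulr1 => [|i ni].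
    have [nI|nI] := boolP (n \in I).
      by rewrite symbol_moment_pilot // mulr0 addr0.
    by rewrite /symbol_moment (negbTE nI) moment22 mulr1 addrC subrK.
  by rewrite (negbTE ni) symbol_moment00.
rewrite mulr0 addr0 big1 // => i _.
have [->|_] := eqVneq i n; first by rewrite (negbTE nm) symbol_moment11.
by have [_|_] := eqVneq i m; [rewrite symbol_moment11|rewrite symbol_moment00].
Qed.

End FixedDoppler.

(** The all-pilot terms resum to [g], while the diagonal corrections contribute N - h. *)
Lemma expected_sqr_dpaf_doppler (k q : 'I_N) : (q : nat) <> 0%N ->
  expected_sqr_dpaf P I c data k q = (g I c k q + N%:R - (h I q)%:R)%:E.
Proof.
move=> q0; rewrite expected_sqr_ambiguity; congr EFin.
rewrite (_ : \sum_(n < N) _ = (g I c k q + N%:R - (h I q)%:R)%:C) //.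
transitivity (\sum_(n < N) \sum_(m < N)
      quad q (pilot I c) n m * (w ^+ (n * k) * conjc (w ^+ (m * k))) +
    \sum_(n < N) (1 - (pilot_mask I n * pilot_mask I (submod n q))%:R : R[i])).
  rewrite -big_split; apply: eq_bigr => n _ /=.
  rewrite (bigD1 n) // [in RHS](bigD1 n) //= -addrA [X in _ = _ + X]addrC addrA.
  congr (_ + _).
    rewrite quad_mean_doppler // eqxx mulr1 mulrDl; congr (_ + _).
    by rewrite mulr_conjc normc_omega expr1n mulr1.
  apply: eq_bigr => m mn; rewrite quad_mean_doppler //.
  by rewrite eq_sym (negbTE mn) mulr0 addr0.
rewrite sumrB sumr_const card_ord -natr_sum -/(h I q).
rewrite rmorphB rmorphD !rmorph_nat /= -addrA; congr (_ + _).
rewrite g_ambiguity -mulr_conjc /ambiguity conjc_sum mulr_suml; apply: eq_bigr => n _.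
rewrite mulr_sumr; apply: eq_bigr => m _.
by rewrite /quad !conjcM; ring.
Qed.

(** The constant part of the means gives the squared modulus of a sum of roots of unity; the excess
    kurtosis - 1 occurs once for each of the N - L data symbols. *)
Lemma expected_sqr_dpaf_zero (k q : 'I_N) : (q : nat) = 0%N ->
  expected_sqr_dpaf P I c data k q =
  (N%:R ^+ 2 * ((k : nat) == 0%N)%:R + (kurtosis PP D - 1) * (N%:R - #|I|%:R))%:E.
Proof.
move=> q0; rewrite expected_sqr_ambiguity; congr EFin.
rewrite (_ : \sum_(n < N) _ = (N%:R ^+ 2 * ((k : nat) == 0%N)%:R +
  (kurtosis PP D - 1) * (N%:R - #|I|%:R))%:C) //.
have sw : \sum_(n < N) w ^+ (n * k) = N%:R * ((k : nat) == 0%N)%:R.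
  under eq_bigr do rewrite mulnC exprM.
  rewrite sum_expr_unity; last by rewrite -exprM mulnC exprM omegaN ?expr1n.
  rewrite -(prim_order_dvd (omega_prim R (ord_pos k))).
  have [->|k0] := posnP k; first by rewrite dvdn0 mulr1.
  by rewrite gtnNdvd // mulr0.
transitivity (\sum_(n < N) \sum_(m < N) (w ^+ (n * k) * conjc (w ^+ (m * k))) +
    \sum_(n < N) ((kurtosis PP D)%:C - 1) * (n \notin I)%:R).
  rewrite -big_split; apply: eq_bigr => n _ /=.
  rewrite (bigD1 n) // [in RHS](bigD1 n) //= -addrA [X in _ = _ + X]addrC addrA.
  congr (_ + _).
    rewrite quad_mean_zero // eqxx /= mulrDl mul1r; congr (_ + _).
    by rewrite mulr_conjc normc_omega expr1n mulr1.
  apply: eq_bigr => m mn; rewrite quad_mean_zero //.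
  by rewrite eq_sym (negbTE mn) mulr0 addr0 mul1r.
have -> : \sum_(n < N) ((kurtosis PP D)%:C - 1) * (n \notin I)%:R =
    ((kurtosis PP D)%:C - 1) * (N%:R - #|I|%:R).
  rewrite -mulr_sumr; congr (_ * _); rewrite -natr_sum.
  have -> : (\sum_(n < N) (n \notin I) = #|~: I|)%N.
    by rewrite -sum1_card [RHS]big_mkcond; apply: eq_bigr => n _; rewrite inE; case: ifP.
  have e : (N = #|I| + #|~: I|)%N by rewrite cardsC card_ord.
  by rewrite [X in _ = X%:R - _]e natrD addrC addKr.
rewrite rmorphD !rmorphM !rmorphB rmorph1 !rmorph_nat /=; congr (_ + _).
rewrite (eq_bigr (fun n : 'I_N =>
    w ^+ (n * k) * conjc (\sum_(m < N) w ^+ (m * k)))) => [|n _].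
  rewrite -mulr_suml sw; case: eqP => _; rewrite ?mulr1 ?mulr0 ?mul0r //.
  by rewrite conjc_nat.
by rewrite conjc_sum mulr_sumr.
Qed.

End ExpectedAmbiguity.

(** * The expectation for chirp pilots and the final assembly *)

Lemma expected_sqr_dpaf_chirp (R : realType) (N : nat) (I : {set 'I_N})
    (c : 'I_N -> R[i])
    (dd : measure_display) (TT : measurableType dd) (PP : probability TT R)
    (D : TT -> R[i]) (d : measure_display) (T : measurableType d)
    (P : probability T R) (data : 'I_N -> T -> R[i])
    (i0 : 'I_N) (A : R[i]) (u nu : int) (k q : 'I_N) :
  data_symbol PP D -> iid_copies P (~: I) data PP D -> (0 < #|I|)%N ->
  (#|I| %| N)%N -> equally_spaced I (N %/ #|I|) -> i0 \in I ->
  normc A = 1 -> chirp_pilots #|I| I c i0 A u nu ->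
  expected_sqr_dpaf P I c data k q = (chirp_sqr_dpaf #|I| (kurtosis PP D) u k q)%:E.
Proof.
move=> hD hdata L0 LN eqI i0I A1 ch.
have hc := chirp_pilots_norm L0 LN eqI i0I A1 ch.
have T0 : (0 < N %/ #|I|)%N by case: eqI.
rewrite /chirp_sqr_dpaf; have [q0|/eqP q0] := eqVneq (q : nat) 0%N.
  by rewrite (expected_sqr_dpaf_zero hc hD hdata).
rewrite (expected_sqr_dpaf_doppler hc hD hdata) //; congr EFin.
have [Tq|Tq] := boolP (N %/ #|I| %| q)%N; last first.
  have [-> ->] := g_chirp_other c LN eqI k Tq.
  rewrite add0r subr0 !ifF //; apply/existsP => -[m /and3P[_ /eqP qm _]];
    by rewrite qm dvdn_mull in Tq.
have [m qm] := dvdnP Tq.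
have mL : (m < #|I|)%N by rewrite -(ltn_pmul2r T0) -qm (period_mul LN).
have m0 : (0 < m)%N by rewrite lt0n; apply: contra_not_neq q0 => m0; rewrite qm m0.
(* The multiplier is determined by [q], so the existential tests in [chirp_sqr_dpaf] concern this
   [m] alone. *)
have uniq (j : 'I_#|I|) : q == (j * (N %/ #|I|))%N :> nat -> j = m :> nat.
  by rewrite qm eqn_pmul2r // => /eqP.
rewrite (h_period eqI qm) (g_chirp_period L0 LN eqI i0I A1 ch k qm mL).
case: ifP => [km|/negbT km].
  rewrite ifT; first by rewrite [X in X - _]addrC.
  by apply/existsP; exists (Ordinal mL); rewrite /= m0 qm eqxx.
rewrite ifF; last first.
  by apply/existsP => -[j /and3P[_ /uniq -> ]]; rewrite (negbTE km).
rewrite ifT ?add0r //.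
by apply/existsP; exists (Ordinal mL); rewrite /= m0 qm eqxx.
Qed.


Theorem proposition3 (R : realType) (N L : nat) (hL : (1 <= L <= N)%N)
    (I : {set 'I_N}) (hI : #|I| = L)
    (c : 'I_N -> R[i]) (hc : forall i : 'I_N, i \in I -> normc (c i) = 1)
    (dd : measure_display) (TT : measurableType dd) (PP : probability TT R)
    (D : TT -> R[i]) (hD : data_symbol PP D)
    (d : measure_display) (T : measurableType d) (P : probability T R)
    (data : 'I_N -> T -> R[i]) (hdata : iid_copies P (~: I) data PP D) :
  (* (A) *)
  [/\ #|Lset I c|%:R <= N%:R / L%:R * (L%:R - 1) * #|Dset I|%:R :> R
    & N%:R / L%:R * (L%:R - 1) * #|Dset I|%:R
        <= N%:R / L%:R * (L%:R - 1) ^+ 2 :> R] /\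
  (* (B) *)
  [/\ #|Uset I c|%:R <= N%:R / L%:R * #|Dset I|%:R :> R
    & N%:R / L%:R * #|Dset I|%:R <= N%:R / L%:R * (L%:R - 1) :> R] /\
  (* both inequalities of (A) tight *)
  (#|Lset I c|%:R = N%:R / L%:R * (L%:R - 1) * #|Dset I|%:R :> R ->
   N%:R / L%:R * (L%:R - 1) * #|Dset I|%:R
     = N%:R / L%:R * (L%:R - 1) ^+ 2 :> R ->
   [/\ (L %| N)%N, equally_spaced I (N %/ L)
     & forall i0 : 'I_N, i0 \in I ->
       exists (A : R[i]) (u nu : int),
         normc A = 1 /\ chirp_pilots L I c i0 A u nu]) /\
  (* both inequalities of (B) tight *)
  (#|Uset I c|%:R = N%:R / L%:R * #|Dset I|%:R :> R ->
   N%:R / L%:R * #|Dset I|%:R = N%:R / L%:R * (L%:R - 1) :> R ->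
   [/\ (L %| N)%N, equally_spaced I (N %/ L)
     & forall i0 : 'I_N, i0 \in I ->
       exists (A : R[i]) (u nu : int),
         normc A = 1 /\ chirp_pilots L I c i0 A u nu]) /\
  (* expected squared DP-AF under (C) *)
  (forall (i0 : 'I_N) (A : R[i]) (u nu : int),
     (L %| N)%N -> equally_spaced I (N %/ L) -> i0 \in I ->
     normc A = 1 -> chirp_pilots L I c i0 A u nu ->
     forall k q : 'I_N,
       expected_sqr_dpaf P I c data k q
         = (chirp_sqr_dpaf L (kurtosis PP D) u k q)%:E) /\
  (* independence of A and nu *)
  (forall (c' : 'I_N -> R[i]) (i0 : 'I_N) (A A' : R[i]) (u nu nu' : int),
     (L %| N)%N -> equally_spaced I (N %/ L) -> i0 \in I ->
     normc A = 1 -> chirp_pilots L I c i0 A u nu ->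
     normc A' = 1 -> chirp_pilots L I c' i0 A' u nu' ->
     forall k q : 'I_N,
       expected_sqr_dpaf P I c data k q = expected_sqr_dpaf P I c' data k q) /\
  (* (C) with A = 1, nu = 0 *)
  (forall (u : int) (l : nat), (l < L)%N ->
     chirp L (1 : R[i]) u 0 l = zadoff_chu R L u l).
Proof.
subst L; have /andP[L0 LN'] := hL.
have LR : 0 < #|I|%:R :> R by rewrite ltr0n.
have NR : 0 < N%:R :> R by rewrite ltr0n (leq_trans L0).
have NL : 0 < N%:R / #|I|%:R :> R by rewrite divr_gt0.
have DL := Dset_bound R L0.
have L1 : 0 <= #|I|%:R - 1 :> R by rewrite subr_ge0 ler1n.
(* Tightness in (A) and in (B) is used only through a [Dset] of full size L - 1 and a peak at each
   of its elements. *)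
have tight : #|Dset I|%:R = #|I|%:R - 1 :> R ->
    (forall q, q \in Dset I -> exists k, g I c k q = #|I|%:R ^+ 2) ->
    [/\ (#|I| %| N)%N, equally_spaced I (N %/ #|I|)
     & forall i0 : 'I_N, i0 \in I ->
       exists (A : R[i]) (u nu : int),
         normc A = 1 /\ chirp_pilots #|I| I c i0 A u nu].
  move=> DE peak.
  have cD : #|Dset I| = #|I|.-1.
    by apply/eqP; rewrite -(eqr_nat R) DE -{1}(prednK L0) -natr1 addrK.
  have [LN eqI] := Dset_full_equally_spaced L0 cD.
  by split => // i0 i0I; exact: peak_chirp.
split; [split|split; [split|split; [|split; [|split; [|split]]]]].
- exact: Lset_bound.
- by rewrite expr2 mulrA ler_wpM2l // mulr_ge0 // ltW.
- exact: Uset_bound.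
- by rewrite ler_wpM2l // ltW.
- move=> e1 e2; apply: tight; last by move=> q; exact: Lset_tight.
  (* For L = 1 the factor L - 1 cannot be cancelled, but then the bound on [Dset] already gives
     0. *)
  move: e2; rewrite expr2 mulrA; have [L10 _|L10] := eqVneq (#|I|%:R - 1 : R) 0.
    by apply/eqP; rewrite eq_le DL L10 ler0n.
  by apply: mulfI; rewrite mulf_neq0 // gt_eqF.
- move=> e1 e2; apply: tight; last by move=> q; exact: Uset_tight.
  by move: e2; apply: mulfI; rewrite gt_eqF.
- by move=> i0 A u nu LN eqI i0I A1 ch k q; exact: expected_sqr_dpaf_chirp ch.
- move=> c' i0 A A' u nu nu' LN eqI i0I A1 ch A1' ch' k q.
  rewrite (expected_sqr_dpaf_chirp k q hD hdata L0 LN eqI i0I A1 ch).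
  by rewrite (expected_sqr_dpaf_chirp k q hD hdata L0 LN eqI i0I A1' ch').
- by move=> u l _; exact: chirp_zadoff_chu.
Qed.
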